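(* There exists a non-zero non-doubling measure $\mu$ on $\mathbb{R}$ such that every tangent measure of $\mu$ is equivalent to Lebesgue measure; that is, for every $x \in \mathbb{R}$ and every $\nu \in \operatorname{Tan}(\mu,x)$ one has $\mathcal{L}^1 \ll \nu \ll \mathcal{L}^1$.
   Context: A measure is always a locally finite Borel measure. $\mathcal{L}^1$ is Lebesgue measure on $\mathbb{R}$ and $B(x,r)$ is the closed ball (interval) with center $x$ and radius $r$. A measure $\mu$ on $\mathbb{R}$ is non-doubling if $D(\mu,x) = \infty$ for $\mu$ almost every $x$, where $D(\mu,x) := \limsup_{r \searrow 0} \frac{\mu(B(x,2r))}{\mu(B(x,r))}$. For $x\in\mathbb{R}$, a non-zero measure $\nu$ on $\mathbb{R}$ is a tangent measure of $\mu$ at $x$ if there are positive constants $c_i$ and $r_i \searrow 0$ such that $\nu$ is the weak limit of $c_i T_{x,r_i\sharp}\mu$ (i.e. integrals of compactly supported continuous functions converge), where $T_{x,r}(y) = (y-x)/r$ and $f_\sharp\mu(A) = \mu(f^{-1}A)$. The set of all tangent measures of $\mu$ at $x$ is $\operatorname{Tan}(\mu,x)$; a tangent measure of $\mu$ is an element of $\operatorname{Tan}(\mu,x)$ for some $x$. *)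

(* Defs.v *)
From HB Require Import structures.
From mathcomp Require Import all_boot all_order all_algebra.
From mathcomp Require Import all_classical all_reals all_analysis.

Set Implicit Arguments.
Unset Strict Implicit.
Unset Printing Implicit Defensive.

Import Order.TTheory GRing.Theory Num.Theory.
Import numFieldNormedType.Exports.

Local Open Scope classical_set_scope.
Local Open Scope ring_scope.

(* [measurableTypeR R] is the real line with its Borel sigma-algebra. *)
Definition locally_finite (R : realType)
    (mu : {measure set (measurableTypeR R) -> \bar R}) : Prop :=
  forall x : R, exists2 U : set R, open_nbhs x U & (mu U < +oo)%E.

(* In [\bar R], 0 / 0 = 0 and a / 0 = +oo for a > 0.  Some closed ball centred
   at x has measure 0 only if x is outside the support of [mu], hence in a
   [mu]-null set, so this convention does not affect [non_doubling]. *)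
Definition doubling_limsup (R : realType)
    (mu : {measure set (measurableTypeR R) -> \bar R}) (x : R) : \bar R :=
  limf_esup (fun r : R =>
    (mu (closed_ball x (2 * r)) / mu (closed_ball x r))%E) 0^'+.

Definition non_doubling (R : realType)
    (mu : {measure set (measurableTypeR R) -> \bar R}) : Prop :=
  {ae mu, forall x, doubling_limsup mu x = +oo%E}.

Definition magnify (R : realType) (x r : R) :
    measurableTypeR R -> measurableTypeR R :=
  fun y => (y - x) / r.

Definition rescaling (R : realType)
    (mu : {measure set (measurableTypeR R) -> \bar R}) (x c r : R) :
    set (measurableTypeR R) -> \bar R :=
  fun A => (c%:E * pushforward mu (magnify x r) A)%E.

Definition compactly_supported (R : realType) (f : R -> R) : Prop :=
  compact (closure [set x | f x != 0]).

Definition weak_limit (R : realType)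
    (m : nat -> set (measurableTypeR R) -> \bar R)
    (nu : set (measurableTypeR R) -> \bar R) : Prop :=
  forall f : R -> R, continuous f -> compactly_supported f ->
    (\int[m i]_y (f y)%:E)%E @[i --> \oo] --> (\int[nu]_y (f y)%:E)%E.

(* Asking moreover for r to be monotone gives the same tangent measures, by
   passing to a subsequence. *)
Definition tangent_measure (R : realType)
    (mu : {measure set (measurableTypeR R) -> \bar R}) (x : R)
    (nu : {measure set (measurableTypeR R) -> \bar R}) : Prop :=
  [/\ locally_finite nu,
      nu setT != 0%E &
      exists c r : nat -> R,
        [/\ forall i, 0 < c i,
            forall i, 0 < r i,
            r @ \oo --> (0 : R) &
            weak_limit (fun i => rescaling mu x (c i) (r i)) nu]].

Definition equivalent_measures (R : realType)
    (mu nu : {measure set (measurableTypeR R) -> \bar R}) : Prop :=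
  mu `<< nu /\ nu `<< mu.

(* Main.v *)
Require Import Defs.
From HB Require Import structures.
From mathcomp Require Import all_boot all_order all_algebra.
From mathcomp Require Import all_classical all_reals all_analysis.
From mathcomp Require Import measurable_realfun.
From mathcomp Require Import ring lra zify.

Import Order.TTheory GRing.Theory Num.Theory.
Import numFieldNormedType.Exports.

Local Open Scope classical_set_scope.
Local Open Scope ring_scope.

(** On every unit interval between integers the measure is the law of a number
with random digits, the same for all these intervals.  At stage [k] every
cell of length [cell_length k] is cut into [arity k] equal children, and its
mass is shared among them in proportion to the values of
[exp (- 1 / max (d s, eps k))], where [s] is the position in units of the cell
length, [d] is the distance to the integers, [eps k = 1 / depth k] tends to 0
very slowly, and [arity k] tends to infinity fast.  So every stage digs one
well around each end of each cell.

Non-doubling.  On the ball of radius [eps / 4] around a point at distance about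
[11 eps / 16] from the bottom of the well the density is at its minimum
[exp (- 1 / eps)], while the concentric ball of twice the radius reaches
positions where it is at least [exp (- 16 / (17 eps))]; the ratio of the two
masses tends to infinity with [1 / eps] ([deep_points_ratio]).  The digits of
stage [k] at which this happens have probability at least a constant over [k],
because [depth k] grows only logarithmically, and the digits are independent:
almost every point sees such a digit infinitely often
([eventually_shallow_negligible]).

Tangent measures.  Cells of stage [k] at distance at most [(k + 1) ^ 2] cells
from each other have comparable masses ([cell_mass_comparable]), because
[arity k] is so large that the weights of consecutive digits are nearly equal.
Hence the magnification of [mu] at any point and at a scale [r] with
[scale k.+1 <= r < scale k] is, up to a bounded factor and on cells that are
small compared with [r], the density [y |-> a exp (- 1 / max (d (z + rho y), eps))]
with [rho = r / cell_length k] ([magnified_window]).  Suppose that such windows,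
suitably normalised, converge to a nonzero locally finite measure, so that their
mass on a fixed large interval is bounded above and their mass near the origin is
bounded below.
- If [rho] is bounded below, the density is far from the wells on most of the
  window, whence bounds on [a]; the density is at most a constant, and at least a
  constant outside of a set of small measure ([window_large_scale]).
- If [rho] is small, the density is bounded above and below on the whole window
  ([window_small_scale]).  This is where the shape of the well matters.  If the
  density varied by a large factor [exp L] over a distance [D], then, [1 / s]
  being convex and slowly varying at relative scale, it would grow by a factor
  of order [exp (L / 6)] over the next distance [D] away from the well
  ([inverse_gap], [well_comparable]); this is excluded by the bound on the mass
  of a larger interval.  In other words, where [mu] fails to be doubling it
  grows so fast at all comparable scales that no normalisation converges.
In both cases the mass of a set is at most [C1] times its Lebesgue measure, and at
least [c1] times its Lebesgue measure minus an arbitrarily small error [theta]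
([window_estimates]).  Both inequalities pass to the weak limit, where the first
gives [nu << Leb] ([limit_absolutely_continuous]) and the second, applied
to a compact [nu]-null set, gives [Leb << nu] ([lebesgue_dominated_by_limit]). *)

(** * Measures with prescribed masses on nested grids *)

Lemma lebesgue_stieltjes_itvoc (R : realType) (f : cumulative R R) (a b : R) :
  a <= b -> lebesgue_stieltjes_measure f `]a, b]%classic = (f b - f a)%:E.
Proof.
move=> ab; rewrite /lebesgue_stieltjes_measure/= /measure_extension/=.
rewrite measurable_mu_extE/=; last exact: is_ocitv.
by rewrite wlength_itv_bnd.
Qed.

Section MassDistribution.
Variable R : realType.

(** The discrete antiderivative that vanishes at 0: for negative [i], minus the sum from
[i] to -1. *)
Definition int_primitive (f : int -> R) (i : int) : R :=
  match i with
  | Posz n => \sum_(0 <= j < n) f j%:Z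
  | Negz n => - \sum_(0 <= j < n.+1) f (Negz j)
  end.

Lemma int_primitiveS (f : int -> R) (i : int) :
  int_primitive f (i + 1) = int_primitive f i + f i.
Proof.
case: i => n.
  by rewrite -PoszD addn1 /= big_nat_recr.
rewrite NegzE; case: n => [|n].
  by rewrite addNr /= big_nat1 big_geq// addNr.
have -> : - n.+2%:Z + 1 = Negz n by rewrite NegzE; lia.
rewrite -NegzE /= [in RHS]big_nat_recr//=; ring.
Qed.

Lemma int_step_rect (P : int -> Prop) :
  P 0 -> (forall i, P i <-> P (i + 1)) -> forall i, P i.
Proof.
move=> P0 PS; elim/int_rect => // n IH.
  have -> : n.+1%:Z = n%:Z + 1 by lia.
  exact/(PS _).1.
apply/(PS _).2; have -> : - n.+1%:Z + 1 = - n%:Z by lia.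
exact: IH.
Qed.

Lemma int_primitiveD (f : int -> R) (i : int) (n : nat) :
  int_primitive f (i + n%:Z) = int_primitive f i + \sum_(0 <= d < n) f (i + d%:Z).
Proof.
elim: n => [|n IH]; first by rewrite big_geq// !addr0.
have -> : n.+1%:Z = n%:Z + 1 by lia.
by rewrite addrA int_primitiveS IH big_nat_recr//= addrA.
Qed.

Lemma int_primitive_le (f : int -> R) : (forall i, 0 <= f i) ->
  {homo int_primitive f : i j / i <= j}.
Proof.
move=> f0 i j ij; have -> : j = i + `|j - i|%N%:Z by lia.
by rewrite int_primitiveD lerDl sumr_ge0.
Qed.

(** Both sides have the same value at 0 and the same increments. *)
Lemma int_primitive_refine (f g : int -> R) (N : nat) :
  (forall i, f i = \sum_(0 <= d < N) g (i * N%:Z + d%:Z)) ->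
  forall i, int_primitive g (i * N%:Z) = int_primitive f i.
Proof.
move=> fg; apply: int_step_rect.
  by rewrite mul0r /= !big_geq.
move=> i; rewrite mulrDl mul1r int_primitiveD int_primitiveS -fg.
by split=> [->|/addIr].
Qed.

Variables (N : nat -> nat) (l : nat -> R) (M : nat -> int -> R).
Hypothesis l_gt0 : forall k, 0 < l k.
Hypothesis lS : forall k, l k = l k.+1 * (N k)%:R.
Hypothesis M_ge0 : forall k i, 0 <= M k i.
Hypothesis M_refine :
  forall k i, M k i = \sum_(0 <= d < N k) M k.+1 (i * (N k)%:Z + d%:Z).
Hypothesis M_small : forall e, 0 < e -> exists K, forall k i, (K <= k)%N -> M k i <= e.

Let Phi k := int_primitive (M k).

Lemma mass_refine k m : exists P : nat, l k = l (k + m)%N * P%:R /\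
  forall i, Phi (k + m)%N (i * P%:Z) = Phi k i.
Proof.
elim: m => [|m [P [lP PhiP]]].
  by rewrite addn0; exists 1%N; split=> [|i]; rewrite mulr1.
exists (P * N (k + m))%N; rewrite addnS; split=> [|i].
  by rewrite lP lS natrM; ring.
rewrite PoszM mulrA -PhiP; apply: int_primitive_refine => j; exact: M_refine.
Qed.

Lemma mass_le k k' i i' : i%:~R * l k <= i'%:~R * l k' -> Phi k i <= Phi k' i'.
Proof.
move=> ii'; have [kk'|/ltnW kk'] := leqP k k'.
  have [P [lP <-]] := mass_refine k (k' - k); move: ii'; rewrite lP subnKC//.
  rewrite mulrC -mulrA mulrC ler_pM2r// => h; apply: int_primitive_le => //.
  by rewrite -(ler_int R) intrM mulrC.
have [P [lP <-]] := mass_refine k' (k - k'); move: ii'; rewrite lP subnKC//.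
rewrite [leRHS]mulrC -mulrA [leRHS]mulrC ler_pM2r// => h.
by apply: int_primitive_le => //; rewrite -(ler_int R) intrM mulrC.
Qed.

Let above x := [set y | exists k i, x < i%:~R * l k /\ y = Phi k i].

Lemma mass_above_inf x : has_inf (above x).
Proof.
split.
  exists (Phi 0%N (Num.floor (x / l 0%N) + 1)); exists 0%N, (Num.floor (x / l 0%N) + 1).
  by split=> //; rewrite -ltr_pdivrMr// floorD1_gt.
exists (Phi 0%N (Num.floor (x / l 0%N))) => _ [k [i [xi ->]]].
apply: mass_le; apply: le_trans (ltW xi); rewrite -ler_pdivlMr//; exact: floor_le.
Qed.

(** The infimum over the grid points strictly to the right of [x], rather than the
supremum over those to the left, makes right continuity automatic. *)
Definition mass_cdf (x : R) : R := inf (above x).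

Lemma mass_cdf_nd : nondecreasing mass_cdf.
Proof.
move=> x y xy; apply: lb_le_inf; first by case: (mass_above_inf y).
move=> _ [k [i [yi ->]]]; apply: ge_inf; first by case: (mass_above_inf x).
by exists k, i; split=> //; exact: le_lt_trans xy yi.
Qed.

Lemma mass_cdf_rc : right_continuous mass_cdf.
Proof.
move=> x; apply/cvgrPdist_le => /= e e0.
have [_ [k [i [xi ->]]] hk] := inf_adherent e0 (mass_above_inf x).
near=> y.
have xy : x <= y by near: y; exact: nbhs_right_ge.
have yi : y < i%:~R * l k by near: y; exact: nbhs_right_lt.
rewrite ler0_norm; last by rewrite subr_le0 mass_cdf_nd.
rewrite opprB lerBlDl; apply/ltW/(le_lt_trans _ hk).
apply: ge_inf; first by case: (mass_above_inf y).
by exists k, i.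
Unshelve. all: by end_near. Qed.

HB.instance Definition _ := isCumulative.Build R _ R mass_cdf mass_cdf_nd mass_cdf_rc.

(** The infimum is reached along the grid points that follow [i * l k] in finer and
finer grids: the cells between them are the ones that must be small, since a limit
of their masses would be an atom at [i * l k]. *)
Lemma mass_cdfE k i : mass_cdf (i%:~R * l k) = Phi k i.
Proof.
apply/eqP; rewrite eq_le; apply/andP; split; last first.
  apply: lb_le_inf; first by case: (mass_above_inf (i%:~R * l k)).
  by move=> _ [k' [i' [ii' ->]]]; apply: mass_le; exact: ltW.
apply/ler_addgt0Pl => e e0; have [K hK] := M_small _ e0.
have [P [lP PhiP]] := mass_refine k K.
apply: (@le_trans _ _ (Phi (k + K)%N (i * P%:Z + 1))).
  apply: ge_inf; first by case: (mass_above_inf (i%:~R * l k)).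
  exists (k + K)%N, (i * P%:Z + 1); split=> //.
  by rewrite lP intrD mulrDl mul1r intrM -mulrA [l _ * _]mulrC ltrDl.
by rewrite /Phi int_primitiveS -/(Phi _) PhiP addrC lerD2r hK// leq_addl.
Qed.

(** A consistent system of masses on the cells of nested grids comes from a measure as
soon as the masses tend to 0 uniformly.  The conclusion is for half-open cells, which
partition the line. *)
Lemma mass_distribution : exists mu : {measure set (measurableTypeR R) -> \bar R},
  forall k i, mu `]i%:~R * l k, (i + 1)%:~R * l k]%classic = (M k i)%:E.
Proof.
exists (lebesgue_stieltjes_measure mass_cdf) => k i.
apply: etrans.
  by apply: lebesgue_stieltjes_itvoc; rewrite ler_pM2r// ler_int lerDl.
by rewrite [X in (X - _)%:E]mass_cdfE [X in (_ - X)%:E]mass_cdfE /Phi int_primitiveS addrAC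
  subrr add0r.
Qed.

End MassDistribution.

(** * The well function *)

Section Well.
Variable R : realType.
Implicit Types (s t e : R).

Definition dist_int s : R := Num.min (s - (Num.floor s)%:~R) (1 - (s - (Num.floor s)%:~R)).

Lemma floor_bounds s : 0 <= s - (Num.floor s)%:~R < 1.
Proof.
have /andP[h1 h2] := floor_itv s; rewrite subr_ge0 h1/= ltrBlDl.
by rewrite intrD in h2.
Qed.

Lemma dist_int_le12 s : dist_int s <= 1/2.
Proof.
rewrite /dist_int ge_min; set t := s - _.
by have [h|h] := leP t (1/2); [apply/orP; left|apply/orP; right; lra].
Qed.

Lemma dist_int_le s (n : int) : dist_int s <= `|s - n%:~R|.
Proof.
have /andP[h1 h2] := floor_bounds s; rewrite /dist_int ge_min.
set m := Num.floor s in h1 h2 *.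
have [nm|mn] := leP n m.
  apply/orP; left; have nmR : n%:~R <= m%:~R :> R by rewrite ler_int.
  by rewrite ger0_norm; lra.
apply/orP; right; have nmR : m%:~R + 1 <= n%:~R :> R by rewrite -[1]/(1%:~R) -intrD ler_int lezD1.
by rewrite ler0_norm; lra.
Qed.

Lemma dist_int_attained s : exists n : int, dist_int s = `|s - n%:~R|.
Proof.
have /andP[h1 h2] := floor_bounds s; rewrite /dist_int; case: leP => h.
  by exists (Num.floor s); rewrite ger0_norm.
exists (Num.floor s + 1); rewrite intrD ler0_norm; lra.
Qed.

Lemma dist_int_lip s t : dist_int s <= dist_int t + `|s - t|.
Proof.
have [n ->] := dist_int_attained t; apply: le_trans (dist_int_le s n) _.
have -> : s - n%:~R = (t - n%:~R) + (s - t) by ring.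
exact: ler_normD.
Qed.

Lemma dist_intDz s (n : int) : dist_int (s + n%:~R) = dist_int s.
Proof.
apply/eqP; rewrite eq_le; apply/andP; split.
  have [m ->] := dist_int_attained s; apply: le_trans (dist_int_le _ (m + n)) _.
  by rewrite intrD opprD addrACA subrr addr0.
have [m ->] := dist_int_attained (s + n%:~R); apply: le_trans (dist_int_le _ (m - n)) _.
by rewrite intrD intrN opprD opprK addrA addrAC.
Qed.

Lemma dist_int_id s : 0 <= s <= 1/2 -> dist_int s = s.
Proof.
move=> /andP[s0 s1]; have -> : dist_int s = dist_int (s + 0%:~R) by rewrite addr0.
have f0 : Num.floor s = 0 by apply: floor_def; rewrite add0r; lra.
by rewrite addr0 /dist_int f0 subr0 min_l//; lra.
Qed.

Lemma min_bound (a b c d : R) : (a <= b -> a <= c /\ a <= d) ->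
  (b <= a -> b <= c /\ b <= d) -> Num.min a b <= Num.min c d.
Proof.
move=> h1 h2; rewrite le_min; case: (leP a b) => [/h1|/ltW /h2] [-> ->] //.
Qed.

(** Moving away from a nearest integer increases the distance until the distance 1/4 is passed. *)
Lemma dist_int_away s : exists2 sg : R, sg = 1 \/ sg = -1 &
  forall t, 0 <= t <= 1/4 -> Num.min (dist_int s + t) (1/4) <= dist_int (s + sg * t).
Proof.
have /andP[h1 h2] := floor_bounds s; set m := Num.floor s in h1 h2 *.
have key sg t : 0 <= t <= 1/4 -> (sg = 1 \/ sg = -1) ->
    (s - m%:~R <= 1/2 -> sg = 1) -> (1/2 < s - m%:~R -> sg = -1) ->
    Num.min (dist_int s + t) (1/4) <= dist_int (s + sg * t).
  move=> t01 sgE sg1 sg2; rewrite /dist_int -/m.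
  have [hs|hs] := leP (s - m%:~R) (1/2).
    rewrite (sg1 hs) (mul1r t).
    have -> : Num.floor (s + t) = m by apply: floor_def; rewrite intrD; lra.
    rewrite (_ : Num.min (s - m%:~R) _ = s - m%:~R); last by rewrite min_l//; lra.
    by apply: min_bound; lra.
  rewrite (sg2 hs) (mulN1r t).
  have -> : Num.floor (s - t) = m by apply: floor_def; rewrite intrD; lra.
  rewrite (_ : Num.min (s - m%:~R) _ = 1 - (s - m%:~R)); last by rewrite min_r//; lra.
  by apply: min_bound; lra.
have [hs|hs] := leP (s - m%:~R) (1/2).
  by exists 1 => [|t t01]; [left|apply: key => //; [left|lra]].
by exists (-1) => [|t t01]; [right|apply: key => //; [right|lra]].
Qed.

Definition cutoff_dist e s : R := Num.max (dist_int s) e.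

Definition well e s : R := expR (- (cutoff_dist e s)^-1).

Lemma cutoff_dist_ge e s : e <= cutoff_dist e s.
Proof. by rewrite /cutoff_dist le_max lexx orbT. Qed.

Lemma cutoff_dist_gt0 e s : 0 < e -> 0 < cutoff_dist e s.
Proof. by move=> e0; apply: lt_le_trans (cutoff_dist_ge e s). Qed.

Lemma cutoff_dist_lip e s t : cutoff_dist e s <= cutoff_dist e t + `|s - t|.
Proof.
rewrite /cutoff_dist ge_max; apply/andP; split.
  by apply: le_trans (dist_int_lip s t) _; rewrite lerD2r le_max lexx.
by apply: ler_wpDr => //; rewrite le_max lexx orbT.
Qed.

Lemma well_gt0 e s : 0 < well e s. Proof. exact: expR_gt0. Qed.

Lemma wellDz e s (n : int) : well e (s + n%:~R) = well e s.
Proof. by rewrite /well /cutoff_dist dist_intDz. Qed.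

Lemma le_well e s t : 0 < e -> cutoff_dist e s <= cutoff_dist e t -> well e s <= well e t.
Proof.
move=> e0 st; rewrite /well ler_expR lerN2.
by rewrite lef_pV2// posrE cutoff_dist_gt0.
Qed.

Lemma well_ge e s t : 0 < e -> 0 < t -> t <= dist_int s -> expR (- t^-1) <= well e s.
Proof.
move=> e0 t0 ts; rewrite /well ler_expR lerN2.
have tm : t <= cutoff_dist e s by rewrite /cutoff_dist le_max ts.
by rewrite lef_pV2// posrE// cutoff_dist_gt0.
Qed.

Lemma well_le_half e s : 0 < e -> e <= 1/2 -> well e s <= expR (- 2).
Proof.
move=> e0 e12; rewrite /well ler_expR lerN2 -[2]invrK.
have wle : cutoff_dist e s <= 1/2 by rewrite /cutoff_dist ge_max e12 dist_int_le12.
by rewrite lef_pV2 ?posrE ?cutoff_dist_gt0//; lra.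
Qed.

Lemma well_le1 e s : 0 < e -> well e s <= 1.
Proof. by move=> e0; rewrite /well expR_le1 oppr_le0 invr_ge0 ltW// cutoff_dist_gt0. Qed.

Lemma well_lip e s t : 0 < e -> well e s <= expR (`|s - t| / e ^+ 2) * well e t.
Proof.
move=> e0; rewrite /well -expRD ler_expR.
have := cutoff_dist_lip e t s; rewrite distrC.
have := cutoff_dist_ge e s; have := cutoff_dist_ge e t.
set a := cutoff_dist e s; set b := cutoff_dist e t => eb ea ba.
have a0 : 0 < a by lra.
have b0 : 0 < b by lra.
rewrite -lerBlDr opprK addrC.
have -> : b^-1 - a^-1 = (a - b) / (a * b) by field; rewrite !gt_eqF.
have [ab|ab] := leP a b.
  apply: (@le_trans _ _ 0); last by rewrite divr_ge0// exprn_ge0// ltW.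
  by rewrite pmulr_lle0 ?invr_gt0 ?mulr_gt0// subr_le0.
have := cutoff_dist_lip e s t; rewrite -/a -/b => ab'.
apply: ler_pM; [lra|by rewrite invr_ge0 mulr_ge0// ltW|lra|].
by rewrite lef_pV2 ?posrE ?mulr_gt0 ?exprn_gt0// expr2 ler_pM// ltW.
Qed.

(** The mechanism of the proof.  If [s |-> - 1 / s] increases by a lot between [a] and
[b <= a + D], then it still increases by a lot on the next interval of length [D]: when
[D <= a], all three points are comparable and the increments differ by a constant factor;
when [a < D], all three points are at most [3 * D] and the second increment is at least
[1 / (6 D)]. *)
Lemma inverse_gap (a b D : R) : 0 < a -> a <= b -> b <= a + D -> 0 < D ->
  (a^-1 - b^-1) / 6 <= b^-1 - (b + D)^-1 \/ (6 * D)^-1 <= b^-1 - (b + D)^-1.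
Proof.
move=> a0 ab bD D0; have b0 : 0 < b by lra.
have -> : b^-1 - (b + D)^-1 = D / (b * (b + D)).
  by field; rewrite !gt_eqF//; lra.
have [Da|aD] := leP D a.
  left; have -> : (a^-1 - b^-1) / 6 = (b - a) / (6 * a * b) by field; rewrite !gt_eqF.
  apply: ler_pM; [lra|by rewrite invr_ge0 !mulr_ge0//; lra|lra|].
  by rewrite lef_pV2 ?posrE ?mulr_gt0//; [nra|lra].
right; rewrite -[leLHS]mul1r ler_pdivrMr ?mulr_gt0// mulrAC ler_pdivlMr ?mulr_gt0//; [nra|lra].
Qed.

(** Near any point there is a unit interval, in the magnified coordinate, on which the
density is not much smaller than at the point: go away from the closest well. *)
Lemma well_rises e z r y : 0 < e -> e <= 1/4 -> 0 < r -> r <= 1/4 -> exists2 sg : R,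
  sg = 1 \/ sg = -1 &
  forall t, 0 <= t <= 1 -> expR (- 2) * well e (z + r * y) <= well e (z + r * (y + sg * t)).
Proof.
move=> e0 e4 r0 r4; have [sg sgE h] := dist_int_away (z + r * y).
exists sg => // t /andP[t0 t1].
have /h : 0 <= r * t <= 1/4 by rewrite mulr_ge0 ?(ltW r0)//=; apply: le_trans r4;
  rewrite ler_piMr// ltW.
have -> : z + r * (y + sg * t) = z + r * y + sg * (r * t) by ring.
set s := z + r * y; set s' := s + _.
rewrite ge_min => /orP[h1|h1].
  apply: (@le_trans _ _ (well e s)).
    by rewrite ler_piMl ?ltW ?well_gt0// expR_le1; lra.
  apply: le_well => //; rewrite /cutoff_dist ge_max !le_max lexx orbT andbT.
  by apply/orP; left; apply: le_trans h1; rewrite lerDl mulr_ge0// ltW.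
have : expR (- (1 / 4)^-1) <= well e s' by apply: well_ge => //; lra.
apply: le_trans.
have -> : - (1/4)^-1 = -2 + -2 :> R by lra.
by rewrite expRD ler_pM2l ?expR_gt0// well_le_half//; lra.
Qed.

(** If the density on a window three times larger is at most [C] times its value at
[y1], then it cannot be much smaller than at [y1] at any point [y2] of the window:
between [y2] and [y1] it would grow so fast that, by [inverse_gap], the growth beyond
[y1] would exceed [C].  The last hypothesis says that the magnification [r] is so
small that the second alternative of [inverse_gap] is excluded. *)
Lemma well_comparable e z r T y1 y2 C : 0 < e -> 0 < r -> 0 < T ->
  2 * T * r <= 1/16 -> `|y1| <= T -> `|y2| <= T -> 1 <= C ->
  (forall y3, `|y3| <= 3 * T -> well e (z + r * y3) <= C * well e (z + r * y1)) ->
  C < expR (12 * T * r)^-1 ->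
  expR (- 8) * C ^- 6 * well e (z + r * y1) <= well e (z + r * y2).
Proof.
move=> e0 r0 T0 Tr y1T y2T C1 hC Ce.
set s1 := z + r * y1; set s2 := z + r * y2.
set D := 2 * T * r; have D0 : 0 < D by rewrite /D !mulr_gt0.
have D16 : D <= 1/16 by [].
have C0 : 0 < C by lra.
have CV : C ^- 6 <= 1 by rewrite invf_le1 ?exprn_gt0// exprn_ege1.
have CV0 : 0 < C ^- 6 by rewrite invr_gt0 exprn_gt0.
have e80 : 0 < expR (- 8) :> R by exact: expR_gt0.
have e81 : expR (- 8) <= 1 :> R by rewrite expR_le1; lra.
have g10 := well_gt0 e s1.
have [ba|ab] := leP (cutoff_dist e s1) (cutoff_dist e s2).
  apply: le_trans (le_well _ _ _ e0 ba).
  by rewrite ler_piMl ?(ltW g10)// mulr_ile1 ?(ltW e80) ?(ltW CV0).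
have bE : cutoff_dist e s1 = dist_int s1.
  have := cutoff_dist_ge e s2; move: ab; rewrite /cutoff_dist.
  by case: (leP (dist_int s1) e) => //; lra.
have bD : cutoff_dist e s1 <= cutoff_dist e s2 + D.
  apply: le_trans (cutoff_dist_lip _ _ s2) _; rewrite lerD2l.
  have -> : s1 - s2 = r * (y1 - y2) by rewrite /s1 /s2; ring.
  rewrite normrM gtr0_norm//.
  have : `|y1 - y2| <= 2 * T by apply: le_trans (ler_normB _ _) _; lra.
  by rewrite /D; nra.
have [sg sgE /(_ D) h] := dist_int_away s1.
have {h} : Num.min (dist_int s1 + D) (1 / 4) <= dist_int (s1 + sg * D) by apply: h; lra.
have -> : s1 + sg * D = z + r * (y1 + sg * (2 * T)) by rewrite /s1 /D; ring.
(* [y3] lies at distance [D] from [y1], in the unscaled coordinate, on the side where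
   the well rises *)
set y3 := y1 + _.
have y3T : `|y3| <= 3 * T.
  rewrite /y3 (le_trans (ler_normD _ _))//.
  rewrite normrM (_ : `|sg| = 1); last by case: sgE => ->; rewrite ?normrN normr1.
  by rewrite mul1r gtr0_norm; lra.
set s3 := z + r * y3; rewrite -bE.
have a0 := cutoff_dist_gt0 e s2 e0; have b0 := cutoff_dist_gt0 e s1 e0.
have a0V : 0 < (cutoff_dist e s2)^-1 by rewrite invr_gt0.
case: (leP (1/4) (cutoff_dist e s1 + D)) => [h4 _|h4].
  have ha : 1/8 <= cutoff_dist e s2 by lra.
  have : expR (- 8) <= well e s2.
    rewrite /well ler_expR lerN2 -[8]invrK lef_pV2 ?posrE//; lra.
  apply: le_trans; rewrite -mulrA ler_piMr ?(ltW e80)//.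
  by rewrite mulr_ile1 ?(ltW CV0) ?(ltW g10)// well_le1.
move=> h3; have {}h3 : cutoff_dist e s1 + D <= cutoff_dist e s3 by rewrite [leRHS]/cutoff_dist
  le_max h3.
have g3 : expR (- (cutoff_dist e s1 + D)^-1) <= well e s3.
  by rewrite /well ler_expR lerN2 lef_pV2 ?posrE//; lra.
have {}g3 : expR ((cutoff_dist e s1)^-1 - (cutoff_dist e s1 + D)^-1) <= C.
  rewrite expRD -[X in X * _]invrK -expRN mulrC ler_pdivrMr//.
  exact: le_trans g3 (hC _ y3T).
have [gap|gap] := inverse_gap _ _ _ a0 (ltW ab) bD D0; last first.
  exfalso; have : expR (6 * D)^-1 <= C by apply: le_trans g3; rewrite ler_expR.
  by apply/negP; rewrite -ltNge (_ : 6 * D = 12 * T * r)// /D; ring.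
have {}g3 : expR ((cutoff_dist e s2)^-1 - (cutoff_dist e s1)^-1) <= C ^+ 6.
  have -> : (cutoff_dist e s2)^-1 - (cutoff_dist e s1)^-1
    = 6%:R * (((cutoff_dist e s2)^-1 - (cutoff_dist e s1)^-1) / 6) by lra.
  by rewrite expRM_natl lerXn2r ?nnegrE ?expR_ge0 ?(ltW C0)//; apply: le_trans g3;
    rewrite ler_expR.
apply: (@le_trans _ _ (C ^- 6 * well e s1)).
  by rewrite ler_pM2r// ler_piMl// (ltW CV0).
rewrite mulrC ler_pdivrMr ?exprn_gt0// mulrC.
have -> : well e s1 = expR ((cutoff_dist e s2)^-1 - (cutoff_dist e s1)^-1) * well e s2.
  by rewrite /well -expRD; congr expR; lra.
by rewrite ler_pM2r// well_gt0.
Qed.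

End Well.

(** * Comparison with Lebesgue measure cell by cell *)

Lemma int_le_diff (i j : int) : i <= j -> exists k : nat, j = i + k%:Z.
Proof. by move=> ij; exists `|j - i|%N; lia. Qed.

Section Cells.
Variable R : realType.
Notation mble := (measurableTypeR R).
Implicit Types (m : {measure set mble -> \bar R}).

Definition cell (t0 w : R) (n : nat) : set mble := `]t0 + n%:R * w, t0 + n.+1%:R * w]%classic.

Lemma cell_measurable t0 w n : measurable (cell t0 w n).
Proof. exact: measurable_itv. Qed.

Lemma cell_lebesgue t0 w n : 0 < w -> lebesgue_measure (cell t0 w n) = w%:E.
Proof.
move=> w0; rewrite /cell lebesgue_measure_itv/= lte_fin ltrD2l ltr_pM2r// ltr_nat ltnSn.
by rewrite -EFinB; congr EFin; rewrite -natr1; ring.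
Qed.

Lemma cell_trivIset t0 w (D : set nat) : 0 < w -> trivIset D (cell t0 w).
Proof.
move=> w0; apply/trivIsetP => i j _ _ ij; rewrite -subset0 => y [].
wlog {ij}ij : i j / (i < j)%N.
  move=> H yi yj; move: ij; rewrite neq_ltn => /orP[] ij.
    exact: (H i j).
  exact: (H j i).
rewrite /cell/= !in_itv/= => /andP[_ h1] /andP[h2 _].
have : t0 + i.+1%:R * w <= t0 + j%:R * w by rewrite lerD2l ler_pM2r// ler_nat.
by move=> /= h3; have := lt_le_trans h2 (le_trans h1 h3); rewrite ltxx.
Qed.

Lemma cell_cover t0 w y : 0 < w -> t0 < y -> exists n, cell t0 w n y.
Proof.
move=> w0 ty; have h0 : 0 < (y - t0) / w by rewrite divr_gt0// subr_gt0.
have /andP[h1 h2] := ceil_itv ((y - t0) / w).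
have c0 : 0 < Num.ceil ((y - t0) / w) by rewrite ceil_gt0.
exists `|Num.ceil ((y - t0) / w)|.-1%N; rewrite /cell/= in_itv/=.
have -> : (`|Num.ceil ((y - t0) / w)|.-1)%:R = (Num.ceil ((y - t0) / w) - 1)%:~R :> R.
  by rewrite pmulrn; congr (_ *~ _); lia.
have -> : (`|Num.ceil ((y - t0) / w)|.-1.+1)%:R = (Num.ceil ((y - t0) / w))%:~R :> R.
  by rewrite pmulrn; congr (_ *~ _); lia.
by rewrite -ltrBrDl -ltr_pdivlMr// h1/= -lerBlDl -ler_pdivrMr.
Qed.

Lemma cells_compare m1 m2 t0 w (D : set nat) (k : R) : 0 <= k -> 0 < w ->
  (forall n, D n -> (k%:E * m2 (cell t0 w n) <= m1 (cell t0 w n))%E) ->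
  (k%:E * m2 (\bigcup_(n in D) cell t0 w n) <= m1 (\bigcup_(n in D) cell t0 w n))%E.
Proof.
move=> k0 w0 h.
rewrite !measure_bigcup//; [|by move=> *; exact: cell_measurable|exact: cell_trivIset|
  by move=> *; exact: cell_measurable|exact: cell_trivIset].
rewrite -nneseriesZl//.
apply: lee_nneseries => n; last by move=> /set_mem; exact: h.
by move=> _; rewrite mule_ge0// lee_fin.
Qed.

(** The grid only starts at [t0], which is why [B] must lie to the right of [t0]; the
cells that meet [B] cover it. *)
Lemma cells_lower m t0 w (k : R) (B U : set mble) : 0 <= k -> 0 < w ->
  measurable B -> measurable U -> B `<=` [set y | t0 < y] ->
  (forall n y, cell t0 w n y -> B y -> cell t0 w n `<=` U /\ ((k * w)%:E <= m (cell t0 w n))%E) ->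
  (k%:E * lebesgue_measure B <= m U)%E.
Proof.
move=> k0 w0 mB mU Bt h; pose D := [set n | exists2 y, cell t0 w n y & B y].
have BD : B `<=` \bigcup_(n in D) cell t0 w n.
  move=> y By; have [n ny] := cell_cover _ w _ w0 (Bt _ By).
  by exists n => //; exists y.
have mD : measurable (\bigcup_(n in D) cell t0 w n).
  by apply: bigcup_measurable => n _; exact: cell_measurable.
apply: (@le_trans _ _ (k%:E * lebesgue_measure (\bigcup_(n in D) cell t0 w n))%E).
  by rewrite lee_wpmul2l ?lee_fin// le_measure ?inE.
apply: le_trans (_ : (m (\bigcup_(n in D) cell t0 w n) <= _)%E).
  apply: cells_compare => // n [y ny By].
  by rewrite [X in (_ * X)%E]cell_lebesgue// -EFinM; have [] := h n y ny By.
apply: le_measure; rewrite ?inE//.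
by move=> y' [n [y ny By] ny']; have [+ _] := h n y ny By; apply.
Qed.

Lemma cells_upper m t0 w (k : R) (B U : set mble) : 0 <= k -> 0 < w ->
  measurable B -> measurable U -> B `<=` [set y | t0 < y] ->
  (forall n y, cell t0 w n y -> B y -> cell t0 w n `<=` U /\ (m (cell t0 w n) <= (k * w)%:E)%E) ->
  (m B <= k%:E * lebesgue_measure U)%E.
Proof.
move=> k0 w0 mB mU Bt h; pose D := [set n | exists2 y, cell t0 w n y & B y].
have BD : B `<=` \bigcup_(n in D) cell t0 w n.
  move=> y By; have [n ny] := cell_cover _ w _ w0 (Bt _ By).
  by exists n => //; exists y.
have mD : measurable (\bigcup_(n in D) cell t0 w n).
  by apply: bigcup_measurable => n _; exact: cell_measurable.
have DU : \bigcup_(n in D) cell t0 w n `<=` U.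
  by move=> y' [n [y ny By] ny']; have [+ _] := h n y ny By; apply.
apply: (@le_trans _ _ (m (\bigcup_(n in D) cell t0 w n))).
  by rewrite le_measure ?inE.
apply: (@le_trans _ _ (k%:E * lebesgue_measure (\bigcup_(n in D) cell t0 w n))%E); last first.
  by rewrite lee_wpmul2l ?lee_fin// le_measure ?inE.
rewrite !measure_bigcup//; [|by move=> *; exact: cell_measurable|exact: cell_trivIset|
  by move=> *; exact: cell_measurable|exact: cell_trivIset].
rewrite -nneseriesZl//.
apply: lee_nneseries => n; first by move=> *; exact: measure_ge0.
move=> /set_mem [y ny By].
by rewrite [X in (_ <= _ * X)%E]cell_lebesgue// -EFinM; have [] := h n y ny By.
Qed.

(** The wells seen through the magnification [y |-> z + r * y] occupy a small part of
[-T, T]: about [2 r T + 1] of them, each of length [2 t / r]. *)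
Lemma near_integers_small (T t z r : R) : 0 < T -> 0 < t -> t <= 1 -> 0 < r ->
  exists E : set mble, [/\ measurable E,
    (lebesgue_measure E <= (t * (4 * T + 8 / r))%:E)%E &
    forall y, `|y| <= T -> ~ E y -> t <= dist_int R (z + r * y)].
Proof.
move=> T0 t0 t1 r0; set n0 := Num.floor (z - r * T - t).
have rT0 : 0 < r * T by rewrite mulr_gt0.
pose K := (Num.truncn (2 * (r * T) + 2 * t + 1)).+1.
have K1 : 2 * (r * T) + 2 * t + 1 < K%:R by exact: truncnS_gt.
have K2 : K%:R <= 2 * (r * T) + 2 * t + 2.
  have h : 0 <= 2 * (r * T) + 2 * t + 1 by lra.
  by have /andP[] := truncn_itv h; rewrite /K -natr1; lra.
pose I i : set mble := `[(n0%:~R + i%:R - z) / r - t / r,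
  (n0%:~R + i%:R - z) / r + t / r]%classic.
exists (\bigcup_(i in [set j | (j < K)%N]) I i); split.
- by apply: bigcup_measurable => i _; exact: measurable_itv.
- rewrite bigcup_mkord.
  apply: (@le_trans _ _ (\sum_(i < K) lebesgue_measure (I i))%E).
    apply: content_subadditive => //.
      by move=> i _; exact: measurable_itv.
    by apply: bigsetU_measurable => i _; exact: measurable_itv.
  have IE i : lebesgue_measure (I i) = (2 * (t / r))%:E.
    rewrite /I lebesgue_measure_itv/= lte_fin ifT; last first.
      by have : 0 < t / r by [rewrite divr_gt0//]; lra.
    by rewrite -EFinB; congr EFin; ring.
  rewrite (eq_bigr (fun=> (2 * (t / r))%:E)) => [|i _]; last exact: IE.
  rewrite sumEFin lee_fin sumr_const card_ord -[leLHS]mulr_natr.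
  apply: (@le_trans _ _ (2 * (t / r) * (2 * (r * T) + 4))).
    rewrite ler_pM2l ?mulr_gt0 ?invr_gt0//; lra.
  rewrite le_eqVlt; apply/orP; left; apply/eqP; field; rewrite gt_eqF//.
- move=> y yT; apply: contra_notP => /negP; rewrite -ltNge => hy.
  have [n nE] := dist_int_attained R (z + r * y).
  move: hy; rewrite nE ltr_norml => /andP[hy1 hy2].
  have /andP[f1 f2] := floor_itv (z - r * T - t).
  rewrite -/n0 intrD in f1 f2.
  have [ry1 ry2] : - (r * T) <= r * y /\ r * y <= r * T.
    by move: yT; rewrite ler_norml => /andP[y1 y2]; rewrite -mulrN !ler_pM2l.
  have n0n : n0 <= n.
    by rewrite -(ler_int R); lra.
  have [k nk] : exists k : nat, n = n0 + k%:Z by exact: (int_le_diff _ _ n0n).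
  have nE' : n%:~R = n0%:~R + k%:R :> R by rewrite nk intrD.
  exists k => /=.
    by rewrite -(ltr_nat R); apply: lt_trans K1; lra.
  rewrite /I/= in_itv/= -mulrBl -mulrDl ler_pdivrMr// ler_pdivlMr// -nE' [y * r]mulrC.
  by apply/andP; split; lra.
Qed.
End Cells.

(** * Windows with a well density *)

Section Window.
Variable R : realType.
Notation mble := (measurableTypeR R).
Local Notation itvN W := (`[(- W)%R, W%R]%classic).
Implicit Types (m : {measure set mble -> \bar R}) (w a z rho e W k T d C y : R).

(** The measure [m] looks, at the resolution of a grid of mesh [w] and on [-W, W],
like the density [a * well e (z + rho * y)].  The cells are indexed by natural numbers
from a point [t0] to the left of the window. *)
Definition well_window m (w a z rho e W : R) : Prop := exists2 t0, t0 < - W &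
  forall n y, cell R t0 w n y -> `|y| <= W ->
    ((expR (- 2) * (a * well R e (z + rho * y)) * w)%:E <= m (cell R t0 w n))%E /\
    (m (cell R t0 w n) <= (expR 2 * (a * well R e (z + rho * y)) * w)%:E)%E.

Definition thickened (w : R) (B U : set mble) :=
  forall y y', B y -> `|y - y'| <= w -> U y'.

Lemma cell_thickened t0 w n (B U : set mble) y : thickened w B U ->
  cell R t0 w n y -> B y -> cell R t0 w n `<=` U.
Proof.
move=> BU ny By y' ny'; apply: BU By _.
move: ny ny'; rewrite /cell/= !in_itv/= -natr1 mulrDl mul1r.
by move=> /andP[h1 h2] /andP[h3 h4]; rewrite ler_norml; apply/andP; split; lra.
Qed.

Lemma window_lower m w a z rho e W k (B U : set mble) :
  0 < w -> well_window m w a z rho e W -> 0 <= k ->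
  measurable B -> measurable U -> B `<=` [set y | `|y| <= W] -> thickened w B U ->
  (forall y, B y -> k <= expR (- 2) * (a * well R e (z + rho * y))) ->
  (k%:E * lebesgue_measure B <= m U)%E.
Proof.
move=> w0 [t0 tW h] k0 mB mU BW BU hk.
apply: (@cells_lower R m t0 w) => //.
  by move=> y /BW /=; rewrite ler_norml => /andP[+ _]; apply: lt_le_trans.
move=> n y ny By; split; first exact: cell_thickened BU ny By.
have [+ _] := h n y ny (BW _ By); apply: le_trans.
by rewrite lee_fin ler_pM2r// hk.
Qed.

Lemma window_upper m w a z rho e W k (B U : set mble) :
  0 < w -> well_window m w a z rho e W -> 0 <= k ->
  measurable B -> measurable U -> B `<=` [set y | `|y| <= W] -> thickened w B U ->
  (forall y, B y -> expR 2 * (a * well R e (z + rho * y)) <= k) ->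
  (m B <= k%:E * lebesgue_measure U)%E.
Proof.
move=> w0 [t0 tW h] k0 mB mU BW BU hk.
apply: (@cells_upper R m t0 w) => //.
  by move=> y /BW /=; rewrite ler_norml => /andP[+ _]; apply: lt_le_trans.
move=> n y ny By; split; first exact: cell_thickened BU ny By.
have [_ /le_trans] := h n y ny (BW _ By); apply.
by rewrite lee_fin ler_pM2r// hk.
Qed.

Lemma le_norm_itv (T : R) : [set y | `|y| <= T] = itvN T.
Proof. by apply/seteqP; split=> y /=; rewrite in_itv/= ler_norml. Qed.

Lemma thickened_itv (w a b : R) : thickened w `[a, b]%classic `[a - w, b + w]%classic.
Proof.
move=> y y' /=; rewrite !in_itv/= ler_norml => /andP[h1 h2] /andP[h3 h4].
by apply/andP; split; lra.
Qed.

(** If the density were smaller than this constant on [-T0, T0], the mass would be smaller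
than [d]. *)
Lemma window_witness m w a z rho e W (T0 : R) d : 0 < w -> w <= 1 -> 0 < T0 -> T0 <= W ->
  well_window m w a z rho e W -> 0 < d ->
  (d%:E <= m (itvN T0))%E ->
  exists2 y, `|y| <= T0 & expR (- 2) * d / (4 * T0 + 4) <= a * well R e (z + rho * y).
Proof.
move=> w0 w1 T00 T0W win d0 hd; apply: contrapT => hn.
have T4 : 0 < 4 * T0 + 4 by lra.
have : (m (itvN T0) <= (d / (4 * T0 + 4))%:E * lebesgue_measure (`[(- T0 - w)%R,
  (T0 + w)%R]%classic : set R))%E.
  apply: window_upper w0 win _ _ _ _ _ _.
  - by rewrite divr_ge0// ltW.
  - exact: measurable_itv.
  - exact: measurable_itv.
  - by rewrite -le_norm_itv => y /= yT; exact: le_trans yT T0W.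
  - exact: thickened_itv.
  - move=> y; rewrite -le_norm_itv/= => yT0; rewrite leNgt; apply/negP => hy.
    apply: hn; exists y => //; rewrite -mulrA mulrC.
    by rewrite expRN ler_pdivrMr ?expR_gt0// [leRHS]mulrC ltW.
rewrite lebesgue_measure_itv/= lte_fin ifT; last by lra.
rewrite -EFinB -EFinM => /(le_trans hd); rewrite lee_fin mulrAC ler_pdivlMr//.
by rewrite ler_pM2l//; lra.
Qed.

(** A high value of the density is shared by a unit interval ([well_rises]), so the
bound on the mass bounds the density pointwise. *)
Lemma window_peak m w a z rho e W y C : 0 < w -> w <= 1 -> 0 < a -> 0 < rho -> rho <= 1/4 ->
  0 < e -> e <= 1/4 -> `|y| + 2 <= W -> well_window m w a z rho e W ->
  (m (itvN W) <= C%:E)%E ->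
  a * well R e (z + rho * y) <= expR 4 * C.
Proof.
move=> w0 w1 a0 r0 r4 e0 e4 yW win hC.
have [sg sgE hsg] := well_rises R e z rho y e0 e4 r0 r4.
pose B : set mble := if sg == 1 then `[y, y + 1]%classic else `[y - 1, y]%classic.
have BE : exists b : R, B = `[b, b + 1]%classic /\ y - 1 <= b <= y.
  rewrite /B; case: eqP => _; first by exists y; split=> //; lra.
  by exists (y - 1); split; [rewrite subrK|lra].
have Bh y' : B y' -> exists2 t, 0 <= t <= 1 & y' = y + sg * t.
  rewrite /B; case: eqP => [->|sg1] /=; rewrite in_itv/= => /andP[h1 h2].
    by exists (y' - y); [lra|rewrite mul1r; ring].
  have -> : sg = -1 by case: sgE.
  by exists (y - y'); [lra|rewrite mulN1r; ring].
have [b [{}BE /andP[b1 b2]]] := BE; rewrite BE in Bh.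
have : ((expR (- 4) * (a * well R e (z + rho * y)))%:E * lebesgue_measure (`[b,
  (b + 1)%R]%classic : set R) <= m (itvN W))%E.
  apply: window_lower w0 win _ _ _ _ _ _.
  - by rewrite mulr_ge0 ?expR_ge0// mulr_ge0 ?(ltW a0) ?ltW ?well_gt0.
  - exact: measurable_itv.
  - exact: measurable_itv.
  - move=> y' /=; rewrite in_itv/= => /andP[h1 h2]; rewrite ler_norml.
    by have := ler_norm y; have := ler_norm (- y); rewrite normrN => *; apply/andP; split; lra.
  - move=> u v /=; rewrite !in_itv/= ler_norml => /andP[h1 h2] /andP[h3 h4].
    by have := ler_norm y; have := ler_norm (- y); rewrite normrN => *; apply/andP; split; lra.
  - move=> _ /Bh[t t01 ->]; have -> : - 4 = - 2 + - 2 :> R by lra.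
    rewrite expRD -mulrA ler_pM2l ?expR_gt0// mulrCA ler_pM2l//; exact: hsg.
rewrite lebesgue_measure_itv/= lte_fin ifT; last by lra.
rewrite -EFinB -EFinM => /le_trans/(_ hC); rewrite lee_fin addrAC subrr add0r mulr1.
by rewrite expRN [leLHS]mulrC ler_pdivrMr ?expR_gt0// [C * _]mulrC.
Qed.

Lemma lebesgue_symmetric_itv (T : R) : 0 < T -> lebesgue_measure (itvN T) = (2 * T)%:E.
Proof.
move=> T0; rewrite lebesgue_measure_itv/= lte_fin ifT; last by lra.
by rewrite -EFinB; congr EFin; ring.
Qed.

(** At scales that are small compared with the cell, the density is bounded above by
[window_peak] and below by [well_comparable], starting from the point given by
[window_witness]. *)
Lemma window_small_scale (C d T0 T : R) : 0 < C -> 0 < d -> 0 < T0 -> T0 <= T ->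
  exists r0 C1 c1 : R, [/\ 0 < r0, 0 < C1, 0 < c1 &
  forall m w a z rho e, 0 < w -> w <= 1 -> 0 < a -> 0 < rho -> rho <= r0 ->
  0 < e -> e <= 1/4 -> well_window m w a z rho e (3 * T + 2) ->
  (m (itvN (3 * T + 2)%R) <= C%:E)%E ->
  (d%:E <= m (itvN T0))%E ->
  forall y, `|y| <= T -> c1 <= a * well R e (z + rho * y) <= C1].
Proof.
move=> C0 d0 T00 T0T; have Tp : 0 < T by lra.
pose d2 := expR (- 2) * d / (4 * T0 + 4).
have d20 : 0 < d2 by rewrite /d2 divr_gt0 ?mulr_gt0 ?expR_gt0//; lra.
pose G := 1 + expR 4 * C / d2.
have G1 : 1 <= G by rewrite /G lerDl divr_ge0 ?(ltW d20)// mulr_ge0 ?expR_ge0// ltW.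
have G0 : 0 < G by lra.
have G6 : 0 < G ^- 6 by rewrite invr_gt0 exprn_gt0.
(* the three bounds are those required by [window_peak], by the hypothesis on
   [2 * T * r] in [well_comparable], and by [expR G <= expR (12 * T * r0)^-1] *)
pose r0 := Num.min (1/4) (Num.min (32 * T)^-1 (12 * T * G)^-1).
have r00 : 0 < r0.
  by rewrite /r0 !lt_min !invr_gt0 !mulr_gt0//= andbT; lra.
exists r0, (expR 4 * C), (expR (- 8) * G ^- 6 * d2); split=> //.
- by rewrite mulr_gt0 ?expR_gt0.
- by apply: mulr_gt0 => //; apply: mulr_gt0 => //; exact: expR_gt0.
move=> m w a z rho e w0 w1 a0 rho0; rewrite /r0 !le_min => /and3P[rho1 rho2 rho3].
move=> e0 e4 win hC hd y yT.
(* the unit interval of [window_peak] and the thickening by [w <= 1] explain the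
   radius [3 * T + 2] of the window *)
have up y' : `|y'| <= 3 * T -> a * well R e (z + rho * y') <= expR 4 * C.
  move=> y'T; apply: window_peak w0 w1 a0 rho0 rho1 e0 e4 _ win hC; lra.
apply/andP; split; last by apply: up; lra.
have [|y1 y1T hy1] := window_witness m w a z rho e _ T0 d w0 w1 T00 _ win d0 hd; first lra.
rewrite -/d2 in hy1.
have h : expR (- 8) * G ^- 6 * well R e (z + rho * y1) <= well R e (z + rho * y).
  apply: (well_comparable R e z rho T y1 y G) => //.
  - by move: rho2; rewrite -[_^-1]mul1r ler_pdivlMr ?mulr_gt0//; lra.
  - lra.
  - move=> y3 y3T; rewrite -(ler_pM2l a0) mulrCA; apply: le_trans (up _ y3T) _.
    apply: (@le_trans _ _ (G * d2)); last by rewrite ler_pM2l.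
    by rewrite /G mulrDl mul1r divfK ?gt_eqF// lerDr ltW.
  - apply: (@lt_le_trans _ _ (expR G)).
      by apply: lt_le_trans (expR_ge1Dx _); lra.
    rewrite ler_expR -[leLHS]invrK lef_pV2 ?posrE ?invr_gt0 ?mulr_gt0//.
    move: rho3; rewrite -[leRHS]mul1r ler_pdivlMr ?mulr_gt0// => h.
    by rewrite -[leRHS]mul1r ler_pdivlMr//; lra.
apply: (@le_trans _ _ (expR (- 8) * G ^- 6 * (a * well R e (z + rho * y1)))).
  by rewrite ler_pM2l// mulr_gt0 ?expR_gt0.
by rewrite [leLHS]mulrCA; rewrite (ler_pM2l a0).
Qed.
End Window.

Section WindowEstimates.
Variable R : realType.
Notation mble := (measurableTypeR R).
Local Notation itvN W := (`[(- W)%R, W%R]%classic).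
Implicit Types (m : {measure set mble -> \bar R}) (w a z rho e W k T d C y : R).

(** The lower bound tolerates a loss [theta]: at scales comparable to the cell the
density has no positive lower bound near the wells. *)
Definition density_bounds m w T c1 C1 theta := forall B U : set mble,
  measurable B -> measurable U -> B `<=` [set y | `|y| <= T] -> thickened R w B U ->
  (m B <= C1%:E * lebesgue_measure U)%E /\
  (c1%:E * lebesgue_measure B <= m U + (c1 * theta)%:E)%E.

Lemma measure_le_diff m (B E : set mble) (x : \bar R) : measurable B -> measurable E ->
  (m E <= x)%E -> (m B <= m (B `\` E) + x)%E.
Proof.
move=> mB mE Ex; apply: (@le_trans _ _ (m (B `\` E) + m E)%E); last by rewrite leeD2l.
apply: (@le_trans _ _ (m ((B `\` E) `|` E))); last first.
  by apply: measureU2 => //; exact: measurableD.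
apply: le_measure; rewrite ?inE//.
  by apply: measurableU => //; exact: measurableD.
by move=> y By; have [Ey|nEy] := pselect (E y); [right|left].
Qed.

Lemma density_bounds_weaken m w T c1 C1 c1' C1' theta : 0 <= theta -> 0 <= C1 -> 0 <= c1' ->
  c1' <= c1 -> C1 <= C1' -> density_bounds m w T c1 C1 theta ->
  density_bounds m w T c1' C1' theta.
Proof.
move=> th0 C10 c10 cc CC h B U mB mU BT BU; have [h1 h2] := h B U mB mU BT BU; split.
  apply: le_trans h1 _; rewrite lee_wpmul2r ?lee_fin//.
have [->|c1n0] := eqVneq c1' 0.
  by rewrite !mul0r mul0e adde0.
have c1'0 : 0 < c1' by rewrite lt_neqAle eq_sym c1n0.
have c0 : 0 < c1 by lra.
have : ((c1' / c1)%:E * (c1%:E * lebesgue_measure B) <= (c1' / c1)%:E * (m U + (c1 *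
  theta)%:E))%E.
  by rewrite lee_wpmul2l// lee_fin divr_ge0// ltW.
rewrite muleA -EFinM divfK ?gt_eqF// => /le_trans; apply.
rewrite ge0_muleDr//; last by rewrite lee_fin mulr_ge0// ltW.
rewrite -EFinM mulrA divfK ?gt_eqF// leeD2r// -[leRHS]mul1e lee_wpmul2r// lee_fin.
by rewrite ler_pdivrMr// mul1r.
Qed.

(** At scales at least comparable to the cell most of the window lies away from the bottoms
of the wells, so the amplitude [a] itself is bounded above and below, and the density is
bounded below outside of the small set of [near_integers_small]. *)
Lemma window_large_scale (C d T0 T r0 theta : R) : 0 < C -> 0 < d -> 0 < T0 -> T0 <= T ->
  0 < r0 -> 0 < theta ->
  exists c1 C1 : R, [/\ 0 < c1, 0 < C1 &
  forall m w a z rho e, 0 < w -> w <= 1 -> 0 < a -> r0 <= rho ->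
  0 < e -> e <= 1/4 -> well_window R m w a z rho e (3 * T + 2) ->
  (m (itvN (3 * T + 2)%R) <= C%:E)%E ->
  (d%:E <= m (itvN T0))%E -> density_bounds m w T c1 C1 theta].
Proof.
move=> C0 d0 T00 T0T r00 th0; have Tp : 0 < T by lra.
pose q := 4 * T + 8 / r0.
have q0 : 0 < q by apply: addr_gt0; [lra|rewrite divr_gt0].
(* [t1] makes the part of [-T, T] near the wells of measure at most [T], and [t2]
   makes it of measure at most [theta] *)
pose t1 := T / q; have t10 : 0 < t1 by rewrite divr_gt0.
have t11 : t1 <= 1.
  rewrite /t1 ler_pdivrMr// mul1r /q.
  have : 0 < 8 / r0 by rewrite divr_gt0.
  lra.
pose t2 := Num.min (theta / q) 1.
have t20 : 0 < t2 by rewrite /t2 lt_min divr_gt0//=.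
have t21 : t2 <= 1 by rewrite /t2 ge_min lexx orbT.
pose d2 := expR (- 2) * d / (4 * T0 + 4).
have d20 : 0 < d2 by rewrite /d2 divr_gt0 ?mulr_gt0 ?expR_gt0//; lra.
pose a1 := expR 2 * expR t1^-1 * C / T.
have a10 : 0 < a1 by rewrite /a1 divr_gt0// !mulr_gt0 ?expR_gt0.
exists (expR (- 2) * (d2 * expR (- t2^-1))), (expR 2 * a1); split.
- by rewrite mulr_gt0 ?expR_gt0// mulr_gt0 ?expR_gt0.
- by rewrite mulr_gt0 ?expR_gt0.
move=> m w a z rho e w0 w1 a0 rho0 e0 e4 win hC hd.
have rhop : 0 < rho by lra.
have qle : 4 * T + 8 / rho <= q.
  by rewrite /q lerD2l ler_pM2l// lef_pV2 ?posrE.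
have small t : 0 < t -> t <= 1 -> exists E : set mble, [/\ measurable E,
    (lebesgue_measure E <= (t * q)%:E)%E &
    forall y, `|y| <= T -> ~ E y -> t <= dist_int R (z + rho * y)].
  move=> t0 tle1; have [E [mE hE hE2]] := near_integers_small R T t z rho Tp t0 tle1 rhop.
  exists E; split=> //; apply: le_trans hE _.
  by rewrite lee_fin ler_pM2l.
(* the amplitude is bounded above: most of the window lies far from the wells *)
have aup : a <= a1.
  have [E [mE hE hE2]] := small t1 t10 t11.
  have : ((expR (- 2) * (a * expR (- t1^-1)))%:E * lebesgue_measure ((itvN T :
    set mble) `\` E) <= m (itvN (3 * T + 2)%R))%E.
    apply: (window_lower R m w a z rho e (3 * T + 2)) => //.
    - by rewrite !mulr_ge0 ?expR_ge0// ltW.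
    - by apply: measurableD => //; exact: measurable_itv.
    - by move=> y [/=]; rewrite in_itv/= => /andP[h1 h2] _; rewrite ler_norml; lra.
    - move=> y y' [/=]; rewrite !in_itv/= => /andP[h1 h2] _; rewrite ler_norml => /andP[h3 h4].
      by apply/andP; split; lra.
    - move=> y [/= yT nE]; rewrite ler_pM2l ?expR_gt0// ler_pM2l//.
      by apply: well_ge => //; apply: hE2 => //; rewrite ler_norml; rewrite in_itv/= in yT.
  move=> /le_trans/(_ hC) => h.
  have : (lebesgue_measure (itvN T) <= lebesgue_measure ((itvN T :
    set mble) `\` E) + (t1 * q)%:E)%E.
    exact: measure_le_diff (measurable_itv _) mE hE.
  rewrite lebesgue_symmetric_itv// /t1 divfK ?gt_eqF// => hT.
  have {}hT : (T%:E <= lebesgue_measure ((itvN T : set mble) `\` E))%E.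
    rewrite -(@leeD2rE _ T%:E)//; apply: le_trans hT.
    by rewrite -EFinD lee_fin; lra.
  have : ((expR (- 2) * (a * expR (- t1^-1)))%:E * T%:E <= C%:E)%E.
    by apply: le_trans h; rewrite lee_wpmul2l// lee_fin !mulr_ge0 ?expR_ge0// ltW.
  rewrite -EFinM lee_fin !expRN /a1 => h'.
  rewrite ler_pdivlMr//; move: h'.
  have -> : (expR 2)^-1 * (a * (expR t1^-1)^-1) * T = (a * T) / (expR 2 * expR t1^-1).
    by field; rewrite !gt_eqF// expR_gt0.
  by rewrite ler_pdivrMr ?mulr_gt0 ?expR_gt0// [C * _]mulrC.
have alow : d2 <= a.
  have [|y1 y1T hy1] := window_witness R m w a z rho e _ T0 d w0 w1 T00 _ win d0 hd; first lra.
  by apply: le_trans hy1 _; rewrite ler_piMr ?(ltW a0)// well_le1.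
move=> B U mB mU BT BU; split.
  apply: window_upper w0 win _ mB mU _ BU _.
  - by rewrite mulr_ge0 ?expR_ge0// ltW.
  - by move=> y /BT /=; lra.
  - move=> y _; rewrite ler_pM2l ?expR_gt0//; apply: le_trans aup.
    by rewrite ler_piMr ?(ltW a0)// well_le1.
have [E [mE hE hE2]] := small t2 t20 t21.
have hE' : (lebesgue_measure E <= theta%:E)%E.
  apply: le_trans hE _; rewrite lee_fin -ler_pdivlMr//.
  by rewrite /t2 ge_min lexx.
set c1 := expR (- 2) * _.
have c10 : 0 < c1 by rewrite /c1 mulr_gt0 ?expR_gt0// mulr_gt0 ?expR_gt0.
have : (c1%:E * lebesgue_measure (B `\` E) <= m U)%E.
  apply: window_lower w0 win (ltW c10) _ mU _ _ _.
  - exact: measurableD.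
  - by move=> y [/BT /= + _]; lra.
  - by move=> y y' [By _]; exact: BU.
  - move=> y [/BT/= yT nE]; rewrite /c1 ler_pM2l ?expR_gt0//.
    by apply: ler_pM; rewrite ?expR_ge0 ?(ltW d20)// well_ge// hE2.
move=> h; have hB : (lebesgue_measure B <= lebesgue_measure (B `\` E) + theta%:E)%E.
  exact: measure_le_diff mB mE hE'.
apply: (@le_trans _ _ (c1%:E * (lebesgue_measure (B `\` E) + theta%:E))%E).
  by rewrite lee_wpmul2l// lee_fin ltW.
by rewrite ge0_muleDr ?lee_fin ?(ltW th0)// -EFinM leeD2r.
Qed.

Lemma window_estimates (C d T0 T theta : R) : 0 < C -> 0 < d -> 0 < T0 -> T0 <= T ->
  0 < theta ->
  exists c1 C1 : R, [/\ 0 < c1, 0 < C1 &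
  forall m w a z rho e, 0 < w -> w <= 1 -> 0 < a -> 0 < rho ->
  0 < e -> e <= 1/4 -> well_window R m w a z rho e (3 * T + 2) ->
  (m (itvN (3 * T + 2)%R) <= C%:E)%E ->
  (d%:E <= m (itvN T0))%E -> density_bounds m w T c1 C1 theta].
Proof.
move=> C0 d0 T00 T0T th0; have Tp : 0 < T by lra.
have [r0 [K [k [r00 K0 k0 hs]]]] := window_small_scale R C d T0 T C0 d0 T00 T0T.
have [c2 [C2 [c20 C20 hl]]] := window_large_scale C d T0 T r0 theta C0 d0 T00 T0T r00 th0.
have K20 : 0 < expR 2 * K by rewrite mulr_gt0 ?expR_gt0.
have k20 : 0 < expR (- 2) * k by rewrite mulr_gt0 ?expR_gt0.
have c0 : 0 < Num.min (expR (- 2) * k) c2 by rewrite lt_min k20.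
exists (Num.min (expR (- 2) * k) c2), (Num.max (expR 2 * K) C2); split=> //.
  by rewrite lt_max K20.
move=> m w a z rho e w0 w1 a0 rho0 e0 e4 win hC hd.
have [rs|/ltW rl] := leP rho r0; last first.
  apply: density_bounds_weaken (hl m w a z rho e w0 w1 a0 rl e0 e4 win hC hd).
  - exact: ltW.
  - exact: ltW.
  - exact: ltW.
  - by rewrite ge_min lexx orbT.
  - by rewrite le_max lexx orbT.
have {}hs := hs m w a z rho e w0 w1 a0 rho0 rs e0 e4 win hC hd.
apply: (density_bounds_weaken m w T (expR (- 2) * k) (expR 2 * K)).
- exact: ltW.
- exact: ltW.
- exact: ltW.
- by rewrite ge_min lexx.
- by rewrite le_max lexx.
move=> B U mB mU BT BU; split.
  apply: window_upper w0 win (ltW K20) mB mU _ BU _.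
  - by move=> y /BT /=; lra.
  - by move=> y /BT /hs /andP[_]; rewrite ler_pM2l ?expR_gt0.
have h : ((expR (- 2) * k)%:E * lebesgue_measure B <= m U)%E.
  apply: window_lower w0 win (ltW k20) mB mU _ BU _.
  - by move=> y /BT /=; lra.
  - by move=> y /BT /hs /andP[+ _]; rewrite ler_pM2l ?expR_gt0.
apply: le_trans h _; rewrite leeDl// lee_fin mulr_ge0// ltW//.
Qed.
End WindowEstimates.

(** * Neighbourhoods and plateau functions *)

Section DistSet.
Variable R : realType.
Implicit Types (K : set R) (s w y : R).

Definition dist_set K y : R := inf [set `|y - k| | k in K].

(** Closed, hence measurable, for every nonempty [K], which a union of closed balls need not
be. *)
Definition neighborhood K s : set R := [set y | dist_set K y <= s].

Lemma dist_set_has_inf K y : K !=set0 -> has_inf [set `|y - k| | k in K].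
Proof.
move=> [k Kk]; split; first by exists `|y - k|, k.
by exists 0 => _ [k' _ <-].
Qed.

Lemma dist_set_ge0 K y : K !=set0 -> 0 <= dist_set K y.
Proof.
move=> K0; apply: lb_le_inf; first by case: (dist_set_has_inf K y K0).
by move=> _ [k _ <-].
Qed.

Lemma dist_set_le K k y : K k -> dist_set K y <= `|y - k|.
Proof.
move=> Kk; apply: ge_inf; last by exists k.
by case: (dist_set_has_inf K y _) => //; exists k.
Qed.

Lemma dist_set_near K y s : K !=set0 -> dist_set K y < s -> exists2 k, K k & `|y - k| < s.
Proof.
move=> K0 ys; have [_ [k Kk <-] h] := inf_lt (dist_set_has_inf K y K0).1 ys.
by exists k.
Qed.

Lemma dist_set_lip K y y' : K !=set0 -> dist_set K y <= dist_set K y' + `|y - y'|.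
Proof.
move=> K0; apply/ler_addgt0Pr => e e0.
have [k Kk hk] : exists2 k, K k & `|y' - k| < dist_set K y' + e.
  by apply: dist_set_near => //; rewrite ltrDl.
apply: le_trans (dist_set_le K k y Kk) _.
have -> : y - k = (y' - k) + (y - y') by ring.
apply: le_trans (ler_normD _ _) _; lra.
Qed.

Lemma dist_set_self K k : K k -> dist_set K k = 0.
Proof.
move=> Kk; apply/eqP; rewrite eq_le dist_set_ge0 ?andbT; last by exists k.
by have := dist_set_le K k k Kk; rewrite subrr normr0.
Qed.

Lemma dist_set_continuous K : K !=set0 -> continuous (dist_set K).
Proof.
move=> K0 y; apply/cvgrPdist_le => /= e e0; near=> z.
have zy : `|y - z| <= e by near: z; exact: cvgr_dist_le.
apply: le_trans zy; rewrite ler_norml lerBlDl dist_set_lip// andbT.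
by rewrite lerNl opprB lerBlDl distrC dist_set_lip.
Unshelve. all: by end_near. Qed.

Lemma dist_set_closed K y : closed K -> K !=set0 -> dist_set K y <= 0 -> K y.
Proof.
move=> cK K0 h; apply: cK => B [e /= e0 eB].
have [k Kk hk] : exists2 k, K k & `|y - k| < e.
  by apply: dist_set_near => //; exact: le_lt_trans h e0.
by exists k; split=> //; apply: eB.
Qed.

Lemma neighborhood_closed K s : K !=set0 -> closed (neighborhood K s).
Proof.
move=> K0; apply: (@preimage_closed _ _ (dist_set K) [set x | x <= s]).
  by move=> y _; exact: dist_set_continuous.
exact: closed_le.
Qed.

Lemma neighborhood_measurable K s : K !=set0 ->
  measurable (neighborhood K s : set (measurableTypeR R)).
Proof. by move=> K0; apply: closed_measurable; exact: neighborhood_closed. Qed.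

Lemma sub_neighborhood K s : 0 <= s -> K `<=` neighborhood K s.
Proof. by move=> s0 y Ky; rewrite /neighborhood/= dist_set_self. Qed.

Lemma neighborhood_thickened K s w : K !=set0 ->
  thickened R w (neighborhood K s) (neighborhood K (s + w)).
Proof.
move=> K0 y y' /= ys yw; rewrite /neighborhood/=.
by apply: le_trans (dist_set_lip K y' y K0) _; rewrite lerD// distrC.
Qed.

Lemma neighborhood_itv K T s w : K !=set0 -> K `<=` `[- T, T]%classic -> s < w ->
  neighborhood K s `<=` `[- (T + w), T + w]%classic.
Proof.
move=> K0 KT sw y /= ys; rewrite in_itv/=.
have [k /KT] : exists2 k, K k & `|y - k| < w.
  by apply: dist_set_near => //; exact: le_lt_trans sw.
rewrite /= in_itv/= ltr_norml => /andP[h1 h2] /andP[h3 h4].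
by apply/andP; split; lra.
Qed.

Definition plateau K s y : R := Num.min 1 (Num.max 0 (2 - dist_set K y / s)).

Lemma plateau01 K s y : 0 <= plateau K s y <= 1.
Proof. by rewrite /plateau le_min ler01/= ge_min le_max !lexx. Qed.

Lemma plateau1 K s y : 0 < s -> neighborhood K s y -> plateau K s y = 1.
Proof.
move=> s0 ys; rewrite /plateau min_l// le_max; apply/orP; right.
have : dist_set K y / s <= 1 by rewrite ler_pdivrMr// mul1r.
lra.
Qed.

Lemma plateau0 K s y : 0 < s -> plateau K s y != 0 -> neighborhood K (2 * s) y.
Proof.
move=> s0; apply: contraNP => /negP; rewrite /neighborhood/= -ltNge => h.
rewrite /plateau max_l ?min_r//.
have : 2 <= dist_set K y / s by rewrite ler_pdivlMr// ltW.
lra.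
Qed.

Lemma plateau_continuous K s : K !=set0 -> continuous (plateau K s).
Proof.
move=> K0 y; apply: (@continuous_min _ _ (cst 1) _ y); first exact: cvg_cst.
apply: (@continuous_max _ _ (cst 0) _ y); first exact: cvg_cst.
apply: cvgB; first exact: cvg_cst.
by apply: cvgMr_tmp; exact: dist_set_continuous.
Qed.

Lemma plateau_compact K s T : K !=set0 -> 0 < s -> K `<=` `[- T, T]%classic ->
  compactly_supported (plateau K s).
Proof.
move=> K0 s0 KT; rewrite /compactly_supported.
apply: (@subclosed_compact _ _ `[- (T + 3 * s), T + 3 * s]%classic).
- exact: closed_closure.
- exact: segment_compact.
- have -> : `[- (T + 3 * s), T + 3 * s]%classic = closure `[- (T + 3 * s), T + 3 * s]%classic.
    exact/closure_id/interval_closed.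
  apply: closure_subset => y /= /(plateau0 K s y s0).
  apply: neighborhood_itv => //; lra.
Qed.

End DistSet.

(** * Weak limits *)

Section WeakLimit.
Variable R : realType.
Notation mble := (measurableTypeR R).
Local Notation itvN W := (`[(- W)%R, W%R]%classic).
Implicit Types (m nu : {measure set mble -> \bar R}) (K : set R) (s T : R).

Lemma plateau_measurable K s : K !=set0 ->
  measurable_fun [set: mble] (fun y => (plateau R K s y)%:E).
Proof.
move=> K0; apply/measurable_EFinP.
by apply: continuous_measurable_fun; exact: plateau_continuous.
Qed.

Lemma integral_plateau_ge m K s : K !=set0 -> 0 < s ->
  (m (neighborhood R K s) <= \int[m]_y (plateau R K s y)%:E)%E.
Proof.
move=> K0 s0; have mN := neighborhood_measurable R K s K0.
rewrite -(setIT (neighborhood R K s)) -integral_indic//.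
apply: ge0_le_integral => //.
- by apply/measurable_EFinP; exact: measurable_indic.
- exact: plateau_measurable.
- move=> y _; rewrite lee_fin indicE; case: (boolP (y \in _)) => [|_] /=.
    by rewrite inE => yN; rewrite plateau1.
  by have /andP[] := plateau01 R K s y.
Qed.

Lemma integral_plateau_le m K s : K !=set0 -> 0 < s ->
  (\int[m]_y (plateau R K s y)%:E <= m (neighborhood R K (2 * s)%R))%E.
Proof.
move=> K0 s0; have mN := neighborhood_measurable R K (2 * s) K0.
rewrite -(setIT (neighborhood R K (2 * s))) -integral_indic//.
apply: ge0_le_integral => //.
- by move=> y _; rewrite lee_fin; have /andP[] := plateau01 R K s y.
- exact: plateau_measurable.
- by apply/measurable_EFinP; exact: measurable_indic.
- move=> y _; rewrite lee_fin indicE; case: (boolP (y \in _)) => [_|] /=.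
    by have /andP[] := plateau01 R K s y.
  move/negP; rewrite inE => yN; rewrite leNgt; apply/negP => h.
  by apply: yN; apply: plateau0 => //; rewrite gt_eqF.
Qed.

Section Portmanteau.
Variables (m_ : nat -> {measure set mble -> \bar R}) (nu : {measure set mble -> \bar R}).
Hypothesis lim_m : weak_limit (fun i => m_ i : set mble -> \bar R) nu.

(** This lemma and the next three are the portmanteau inequalities in the form used
below: the plateau function lies between the indicators of the two neighbourhoods. *)
Lemma weak_limit_lt K s T (x : \bar R) : K !=set0 -> K `<=` itvN T -> 0 < s ->
  (nu (neighborhood R K (2 * s)%R) < x)%E ->
  \forall i \near \oo, (m_ i (neighborhood R K s) < x)%E.
Proof.
move=> K0 KT s0 hx.
have cv := lim_m _ (plateau_continuous R K s K0) (plateau_compact R K s T K0 s0 KT).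
have h : \forall i \near \oo, (\int[m_ i]_y (plateau R K s y)%:E < x)%E.
  exact: cv _ (open_ereal_lt' (le_lt_trans (integral_plateau_le nu K s K0 s0) hx)).
near=> i; apply: (le_lt_trans (integral_plateau_ge (m_ i) K s K0 s0)); near: i.
exact: h.
Unshelve. all: by end_near.
Qed.

Lemma weak_limit_gt K s T (x : \bar R) : K !=set0 -> K `<=` itvN T -> 0 < s ->
  (x < nu (neighborhood R K s))%E ->
  \forall i \near \oo, (x < m_ i (neighborhood R K (2 * s)%R))%E.
Proof.
move=> K0 KT s0 hx.
have cv := lim_m _ (plateau_continuous R K s K0) (plateau_compact R K s T K0 s0 KT).
have h : \forall i \near \oo, (x < \int[m_ i]_y (plateau R K s y)%:E)%E.
  exact: cv _ (open_ereal_gt' (lt_le_trans hx (integral_plateau_ge nu K s K0 s0))).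
near=> i; apply: (lt_le_trans _ (integral_plateau_le (m_ i) K s K0 s0)); near: i.
exact: h.
Unshelve. all: by end_near.
Qed.

Lemma weak_limit_le K s T (x : \bar R) : K !=set0 -> K `<=` itvN T -> 0 < s ->
  (\forall i \near \oo, (m_ i (neighborhood R K (2 * s)%R) <= x)%E) ->
  (nu (neighborhood R K s) <= x)%E.
Proof.
move=> K0 KT s0 hx; rewrite leNgt; apply/negP => h.
have h2 := weak_limit_gt K s T x K0 KT s0 h.
near \oo => i.
suff : (x < x)%E by rewrite ltxx.
apply: (@lt_le_trans _ _ (m_ i (neighborhood R K (2 * s)%R))); near: i; [exact: h2|exact: hx].
Unshelve. all: by end_near. Qed.

Lemma weak_limit_ge K s T (x : \bar R) : K !=set0 -> K `<=` itvN T -> 0 < s ->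
  (\forall i \near \oo, (x <= m_ i (neighborhood R K s))%E) ->
  (x <= nu (neighborhood R K (2 * s)%R))%E.
Proof.
move=> K0 KT s0 hx; rewrite leNgt; apply/negP => h.
have h2 := weak_limit_lt K s T x K0 KT s0 h.
near \oo => i.
suff : (x < x)%E by rewrite ltxx.
apply: (@le_lt_trans _ _ (m_ i (neighborhood R K s))); near: i; [exact: hx|exact: h2].
Unshelve. all: by end_near. Qed.

End Portmanteau.

Lemma locally_finite_itv nu T : locally_finite nu -> (nu (itvN T) < +oo)%E.
Proof.
move=> lf.
pose U x := sval (cid2 (lf x)).
have U1 x : open_nbhs x (U x) by rewrite /U; case: cid2.
have U2 x : (nu (U x) < +oo)%E by rewrite /U; case: cid2.
have := @segment_compact R (- T) T; rewrite compact_cover => /(_ _ setT U).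
case.
- by move=> x _; have [] := U1 x.
- by move=> x _; exists x => //; have [] := U1 x.
move=> D _ sub.
apply: (@le_lt_trans _ _ (\sum_(x <- finmap.enum_fset D) nu (U x))%E).
  rewrite (big_nth 0) big_mkord.
  apply: (@content_subadditive _ _ _ nu _ (fun k => U (nth 0 (finmap.enum_fset D) k))).
  - by move=> k _; apply: open_measurable; have [] := U1 (nth 0 (finmap.enum_fset D) k).
  - exact: measurable_itv.
  - move=> y /sub [x /= xD Uxy]; rewrite -(bigcup_mkord _ (fun k =>
      U (nth 0 (finmap.enum_fset D) k))).
    exists (index x (finmap.enum_fset D)); first by rewrite /= index_mem.
    by rewrite nth_index.
elim: (finmap.enum_fset D) => [|x l IH]; first by rewrite big_nil ltry.
by rewrite big_cons lte_add_pinfty.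
Qed.

Lemma measure_itvN_gt0 nu : nu setT != 0%E -> exists2 T, 0 < T & (0 < nu (itvN T))%E.
Proof.
move=> nu0; apply: contrapT => hn.
have h0 n : nu (itvN n.+1%:R) = 0%E.
  apply/eqP; rewrite eq_le measure_ge0 andbT leNgt; apply/negP => h.
  by apply: hn; exists n.+1%:R.
move/eqP: nu0; apply.
have -> : setT = \bigcup_n (itvN n.+1%:R : set mble).
  apply/seteqP; split=> // y _; exists (Num.truncn `|y|) => //=.
  rewrite in_itv/= -ler_norml ltW//; exact: truncnS_gt.
apply/eqP; rewrite eq_le measure_ge0 andbT.
apply: (@le_trans _ _ (\sum_(n <oo) nu (itvN n.+1%:R))%E).
  have mI n : measurable (itvN n.+1%:R : set mble) by exact: measurable_itv.
  apply: (measure_sigma_subadditive nu mI) => //.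
  by apply: bigcup_measurable => n _; exact: mI.
by rewrite eseries0.
Qed.

End WeakLimit.

(** * Limits of windows are equivalent to Lebesgue measure *)

Section TangentEquivalence.
Variable R : realType.
Notation mble := (measurableTypeR R).
Local Notation itvN W := (`[(- W)%R, W%R]%classic).
Local Notation nbr := (neighborhood R).
Implicit Types (m : {measure set mble -> \bar R}) (K : set R) (s T : R).
Variables (m_ : nat -> {measure set mble -> \bar R}) (nu : {measure set mble -> \bar R}).
Hypothesis lim_m : weak_limit (fun i => m_ i : set mble -> \bar R) nu.
Hypothesis windows : forall W u : R, 0 < W -> 0 < u -> \forall i \near \oo,
  exists w a z rho e : R, [/\ 0 < w, w <= u, 0 < a, 0 < rho & 0 < e /\ e <= 1/4 /\
    well_window R (m_ i) w a z rho e W].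
Hypothesis nu_lf : locally_finite nu.
Hypothesis nu_n0 : nu setT != 0%E.

Lemma itvN_n0 T : 0 < T -> (itvN T : set R) !=set0.
Proof. by move=> T0; exists 0; rewrite /= in_itv/= oppr_le0 ltW. Qed.

Lemma neighborhood_itvN T s t : 0 < T -> s < t -> nbr (itvN T) s `<=` itvN (T + t).
Proof. by move=> T0 st; apply: neighborhood_itv => //; exact: itvN_n0. Qed.

(** Convergence to a locally finite nonzero limit provides the two bounds on masses that
[window_estimates] requires, with constants that do not depend on the scale. *)
Lemma limit_density_bounds : exists2 T0 : R, 0 < T0 & forall T theta, T0 <= T -> 0 < theta ->
  exists c1 C1 : R, [/\ 0 < c1, 0 < C1 & forall u, 0 < u ->
    \forall i \near \oo, exists2 w : R, w <= u & density_bounds R (m_ i) w T c1 C1 theta].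
Proof.
have [t t0 nut] := measure_itvN_gt0 R nu nu_n0.
exists (t + 3); first by lra.
move=> T theta tT th0.
have W0 : 0 < 3 * T + 2 by lra.
have nuW := locally_finite_itv R nu (3 * T + 5) nu_lf.
pose C := fine (nu (itvN (3 * T + 5)%R)) + 1.
have C0 : 0 < C by rewrite /C ltr_wpDl// fine_ge0.
(* the neighbourhoods of radius 1 and 2 come from the plateau functions *)
have nuC : (nu (nbr (itvN (3 * T + 2)%R) (2 * 1)) < C%:E)%E.
  apply: (@le_lt_trans _ _ (nu (itvN (3 * T + 5)%R))).
    apply: le_measure; rewrite ?inE.
    - by apply: neighborhood_measurable; exact: itvN_n0.
    - exact: measurable_itv.
    - have -> : 3 * T + 5 = (3 * T + 2) + 3 :> R by ring.
      by apply: neighborhood_itvN => //; lra.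
  by rewrite /C EFinD fineK ?ge0_fin_numE// lteDl// ?ge0_fin_numE// lte_fin.
have nut' : (0 < nu (nbr (itvN t) 1))%E.
  apply: lt_le_trans nut _; apply: le_measure; rewrite ?inE.
  - exact: measurable_itv.
  - by apply: neighborhood_measurable; exact: itvN_n0.
  - by apply: sub_neighborhood; lra.
have [d d0 hd] : exists2 d : R, 0 < d & (d%:E < nu (nbr (itvN t) 1))%E.
  case: (nu (nbr (itvN t) 1)) nut' => [r||]//; last by exists 1; rewrite ?ltry.
  by rewrite lte_fin => r0; exists (r / 2); rewrite ?lte_fin; lra.
have [c1 [C1 [c10 C10 h]]] := window_estimates R C d (t + 3) T theta C0 d0 (ltac:(lra) :
  0 < t + 3) tT th0.
exists c1, C1; split=> // u u0.
have e1 := weak_limit_lt R m_ nu lim_m (itvN (3 * T + 2)) 1 (3 * T + 2) _ (itvN_n0 _ W0) (fun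
  y yT => yT) ltr01 nuC.
have e2 := weak_limit_gt R m_ nu lim_m (itvN t) 1 t _ (itvN_n0 _ t0) (fun y yT => yT) ltr01 hd.
have e3 := windows (3 * T + 2) (Num.min u 1) W0 (ltac:(by rewrite lt_min u0 ltr01)).
near=> i.
have [w [a [z [rho [e [w0 wu a0 rho0 [e0 [e4 win]]]]]]]] : exists w a z rho e : R, [/\ 0 < w,
  w <= Num.min u 1, 0 < a, 0 < rho & 0 < e /\ e <= 1/4 /\
    well_window R (m_ i) w a z rho e (3 * T + 2)] by near: i; exact: e3.
have h1 : (m_ i (nbr (itvN (3 * T + 2)%R) 1) < C%:E)%E by near: i; exact: e1.
have h2 : (d%:E < m_ i (nbr (itvN t) (2 * 1)))%E by near: i; exact: e2.
move: wu; rewrite le_min => /andP[wu w1].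
exists w => //; apply: (h (m_ i) w a z rho e) => //.
  apply: le_trans (ltW h1); apply: le_measure; rewrite ?inE.
  - exact: measurable_itv.
  - by apply: neighborhood_measurable; exact: itvN_n0.
  - by apply: sub_neighborhood; lra.
apply: le_trans (ltW h2) _; apply: le_measure; rewrite ?inE.
- by apply: neighborhood_measurable; exact: itvN_n0.
- exact: measurable_itv.
- by apply: neighborhood_itvN => //; lra.
Unshelve. all: by end_near. Qed.

Lemma limit_upper_density T : exists2 C1 : R, 0 < C1 & forall K s, K !=set0 -> K `<=` itvN T ->
  0 < s -> s <= 1/3 -> (nu (nbr K s) <= C1%:E * lebesgue_measure (nbr K (3 * s)%R))%E.
Proof.
have [T0 T00 hT] := limit_density_bounds.
have [c1 [C1 [c10 C10 h]]] := hT (Num.max T0 (T + 1)) 1 (ltac:(by rewrite le_max lexx)) ltr01.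
exists C1 => // K s K0 KT s0 s3.
apply: (weak_limit_le R m_ nu lim_m K s T _ K0 KT s0).
near=> i.
have [w ws hw] : exists2 w : R, w <= s & density_bounds R (m_ i) w (Num.max T0 (T + 1)) c1 C1
  1 by near: i; exact: h.
have [] // := hw (nbr K (2 * s)) (nbr K (3 * s)).
- exact: neighborhood_measurable.
- exact: neighborhood_measurable.
- have hK : nbr K (2 * s) `<=` itvN (T + 1) by apply: neighborhood_itv => //; lra.
  move=> y /hK /=; rewrite in_itv/= -ler_norml => yT.
  by rewrite le_max yT orbT.
- move=> y y' Ky yy'; have := neighborhood_thickened R K (2 * s) w K0 y y' Ky yy'.
  rewrite /neighborhood/= => /le_trans; apply; lra.
Unshelve. all: by end_near. Qed.

(** The constant [c1] is fixed before [s], so that [s] may tend to 0. *)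
Lemma limit_lower_density T theta : 0 < theta -> exists2 c1 : R, 0 < c1 &
  forall K s, K !=set0 -> K `<=` itvN T -> measurable (K : set mble) -> 0 < s ->
  (c1%:E * lebesgue_measure (K : set mble) <= nu (nbr K (2 * s)%R) + (c1 * theta)%:E)%E.
Proof.
move=> th0; have [T0 T00 hT] := limit_density_bounds.
have [c1 [C1 [c10 C10 h]]] := hT (Num.max T0 T) theta (ltac:(by rewrite le_max lexx)) th0.
exists c1 => // K s K0 KT mK s0; rewrite -leeBlDr//.
apply: (weak_limit_ge R m_ nu lim_m K s T _ K0 KT s0).
near=> i.
have [w ws hw] : exists2 w : R, w <= s & density_bounds R (m_ i) w (Num.max T0 T) c1 C1 theta
  by near: i; exact: h.
rewrite leeBlDr//.
have [] // := hw K (nbr K s).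
- exact: neighborhood_measurable.
- by move=> y /KT /=; rewrite in_itv/= -ler_norml => yT; rewrite le_max yT orbT.
- move=> y y' Ky yy'; rewrite /neighborhood/=.
  by apply: le_trans (dist_set_le R K y y' Ky) _; rewrite distrC (le_trans yy').
Unshelve. all: by end_near. Qed.

(** The part of [U] in [-T, T] is the increasing union of the sets of points at distance
at least [1 / (n + 1)] from the complement of [U], to which [limit_upper_density]
applies inside of [U]. *)
Lemma limit_open_le (T : R) : exists2 C1 : R, 0 < C1 & forall U : set R, open U ->
  (nu (U `&` itvN T) <= C1%:E * lebesgue_measure U)%E.
Proof.
have [C1 C10 hC] := limit_upper_density T.
exists C1 => // U oU.
have [UC0|/set0P UC0] := eqVneq (~` U) set0.
  have -> : U = setT by rewrite -(setCK U) UC0 setC0.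
  rewrite [X in (_ * X)%E](_ : _ = +oo%E); last first.
    by rewrite -set_itvNyy lebesgue_measure_itv.
  by rewrite gt0_muley ?lte_fin// leey.
pose K n := [set y | n.+1%:R^-1 <= dist_set R (~` U) y] `&` itvN T.
have mK n : measurable (K n : set mble).
  apply: measurableI; last exact: measurable_itv.
  apply: closed_measurable; apply: (@preimage_closed _ _ (dist_set R (~` U)) [set x |
    n.+1%:R^-1 <= x]).
    by move=> y _; exact: dist_set_continuous.
  exact: closed_ge.
have KU : U `&` itvN T = \bigcup_n K n.
  apply/seteqP; split=> [y [Uy yT]|y [n _ [/= yn yT]]].
    have d0 : 0 < dist_set R (~` U) y.
      rewrite lt_neqAle dist_set_ge0// andbT; apply/eqP => d0.
      have : (~` U) y by apply: dist_set_closed => //; [exact: open_closedC|rewrite -d0].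
      by apply.
    exists (Num.truncn (dist_set R (~` U) y)^-1) => //; split=> //=.
    rewrite -[leRHS]invrK lef_pV2 ?posrE ?invr_gt0// ltW//; exact: truncnS_gt.
  split=> //; apply: contrapT => nUy.
  by move: yn; rewrite dist_set_self// leNgt invr_gt0 ltr0n.
have Kle n : (nu (K n) <= C1%:E * lebesgue_measure U)%E.
  have [->|/set0P Kn0] := eqVneq (K n) set0.
    by rewrite measure0 mule_ge0// lee_fin ltW.
  pose s : R := n.+1%:R^-1 / 4.
  have s0 : 0 < s by rewrite divr_gt0// invr_gt0 ltr0n.
  have s1 : s <= 1/3.
    have h : n.+1%:R^-1 <= 1 :> R by rewrite invf_le1 ?ltr0n// ler1n.
    by rewrite /s ler_pdivrMr//; apply: le_trans h _; lra.
  have KT : K n `<=` itvN T by move=> y [].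
  apply: le_trans (_ : (nu (nbr (K n) s) <= _)%E).
    apply: le_measure; rewrite ?inE//; first exact: neighborhood_measurable.
    by apply: sub_neighborhood; exact: ltW.
  apply: le_trans (hC _ s Kn0 KT s0 s1) _.
  rewrite lee_wpmul2l ?lee_fin ?(ltW C10)//.
  apply: le_measure; rewrite ?inE//.
  - exact: neighborhood_measurable.
  - exact: open_measurable.
  - move=> y hy; apply: contrapT => nUy.
    have [k [/= kn _] yk] : exists2 k, K n k & `|y - k| < n.+1%:R^-1.
      apply: dist_set_near => //; apply: le_lt_trans hy _.
      have -> : n.+1%:R^-1 = 4 * s by rewrite /s mulrC divfK.
      lra.
    have := dist_set_le R (~` U) y k nUy; rewrite distrC => h.
    by have := lt_le_trans yk (le_trans kn h); rewrite ltxx.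
have cv : nu \o K @ \oo --> nu (\bigcup_n K n).
  apply: nondecreasing_cvg_mu => //; first by apply: bigcup_measurable => n _; exact: mK.
  move=> p q pq; apply/subsetPset => y [/= h1 h2]; split=> //=.
  by apply: le_trans h1; rewrite lef_pV2 ?posrE ?ltr0n// ler_nat.
rewrite KU -(cvg_lim _ cv)//; apply: lime_le; first by apply/cvg_ex; eexists; exact: cv.
by apply: nearW => n; exact: Kle.
Qed.

Lemma limit_absolutely_continuous : nu `<< lebesgue_measure.
Proof.
apply/null_content_dominatesP => A mA LA0.
have AE : A = \bigcup_n (A `&` itvN n.+1%:R).
  apply/seteqP; split=> [y Ay|y [n _ []//]]; exists (Num.truncn `|y|) => //=; split=> //=.
  rewrite in_itv/= -ler_norml ltW//; exact: truncnS_gt.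
have mAn n : measurable (A `&` itvN n.+1%:R : set mble) by apply: measurableI => //; exact:
  measurable_itv.
have A0 n : nu (A `&` itvN n.+1%:R) = 0%E.
  apply/eqP; rewrite eq_le measure_ge0 andbT.
  have [C1 C10 hC] := limit_open_le n.+1%:R.
  apply/lee_addgt0Pr => e e0; rewrite add0e.
  have [U [oU AU hU]] := lebesgue_regularity_outer mA (ltac:(by rewrite [X in (X < _)%E]LA0
    ltry)) (divr_gt0 e0 C10).
  have LU : (lebesgue_measure U <= (e / C1)%:E)%E.
    apply: (@le_trans _ _ (lebesgue_measure (U `\` A) + 0)%E); last by rewrite adde0 ltW.
    by apply: measure_le_diff => //; [exact: open_measurable|rewrite [leLHS]LA0].
  apply: (@le_trans _ _ (nu (U `&` itvN n.+1%:R))).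
    apply: le_measure; rewrite ?inE//; last by apply: setSI.
    by apply: measurableI; [exact: open_measurable|exact: measurable_itv].
  apply: le_trans (hC U oU) _.
  apply: (@le_trans _ _ (C1%:E * (e / C1)%:E)%E).
    by rewrite lee_wpmul2l// lee_fin ltW.
  by rewrite -EFinM lee_fin mulrC divfK// gt_eqF.
apply/eqP; rewrite eq_le measure_ge0 andbT AE.
apply: (@le_trans _ _ (\sum_(n <oo) nu (A `&` itvN n.+1%:R))%E).
  apply: (measure_sigma_subadditive nu mAn) => //.
  by apply: bigcup_measurable => n _; exact: mAn.
by rewrite eseries0.
Qed.

(** A set of positive Lebesgue measure contains a compact set [K] of positive measure
[x]; with the error [x / 2], its neighbourhoods have [nu]-measure at least
[c1 * x / 2], and so has [K] by continuity from above. *)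
Lemma lebesgue_dominated_by_limit : lebesgue_measure `<< nu.
Proof.
apply/null_content_dominatesP => A mA nuA0.
apply/eqP; rewrite eq_le measure_ge0 andbT leNgt; apply/negP => LA.
move: LA; rewrite lebesgue_regularity_inner_sup// => /ereal_sup_gt[_ [K [cK KA] <-] LK].
have K0 : K !=set0.
  by apply/set0P; apply/eqP => K0; move: LK; rewrite K0 measure0 ltxx.
have clK : closed K by apply: compact_closed => //; exact: Rhausdorff.
have mK : measurable (K : set mble) by exact: compact_measurable.
have [T KT] : exists T, K `<=` itvN T.
  have [M [_ hM]] := compact_bounded cK.
  exists (M + 1) => y Ky; rewrite /= in_itv/= -ler_norml.
  by apply: hM => //; lra.
have LKfin : (lebesgue_measure (K : set mble) < +oo)%E.
  apply: (@le_lt_trans _ _ (lebesgue_measure (itvN T : set mble))).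
    by apply: le_measure; rewrite ?inE//; exact: measurable_itv.
  by rewrite lebesgue_measure_itv/=; case: ifP => _; rewrite ?ltry// -EFinD ltry.
pose x := fine (lebesgue_measure (K : set mble)).
have Lx : lebesgue_measure (K : set mble) = x%:E by rewrite /x fineK// ge0_fin_numE.
have x0 : 0 < x by rewrite -lte_fin -Lx.
have [c1 c10 hc] := limit_lower_density T (x / 2) (ltac:(lra)).
pose F n := nbr K n.+1%:R^-1.
have mF n : measurable (F n : set mble) by exact: neighborhood_measurable.
have FK : \bigcap_n F n = K.
  apply/seteqP; split=> y; last by move=> Ky n _; apply: sub_neighborhood => //; rewrite invr_ge0.
  move=> hy; apply: dist_set_closed => //; apply/ler_addgt0Pr => e e0; rewrite add0r.
  apply: le_trans (hy (Num.truncn e^-1) I) _.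
  by rewrite -[leRHS]invrK lef_pV2 ?posrE ?invr_gt0// ltW//; exact: truncnS_gt.
have Fge n : ((c1 * (x / 2))%:E <= nu (F n))%E.
  have s0 : 0 < n.+1%:R^-1 / 2 :> R by rewrite divr_gt0// invr_gt0 ltr0n.
  have := hc K _ K0 KT mK s0.
  have -> : 2 * (n.+1%:R^-1 / 2) = n.+1%:R^-1 :> R by rewrite mulrC divfK.
  rewrite Lx -leeBlDr// -EFinM -EFinB; apply: le_trans.
  by rewrite lee_fin; lra.
have cv : nu \o F @ \oo --> nu (\bigcap_n F n).
  apply: nonincreasing_cvg_mu => //.
  - apply: (@le_lt_trans _ _ (nu (itvN (T + 2)))); last exact:
      (locally_finite_itv R nu (T + 2) nu_lf).
    apply: le_measure; rewrite ?inE//.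
    apply: neighborhood_itv => //; rewrite invr1; lra.
  - by rewrite FK.
  - move=> p q pq; apply/subsetPset => y /=; rewrite /F/neighborhood/= => /le_trans; apply.
    by rewrite lef_pV2 ?posrE ?ltr0n// ler_nat.
have : ((c1 * (x / 2))%:E <= nu (\bigcap_n F n))%E.
  rewrite -(cvg_lim _ cv)//; apply: lime_ge; first by apply/cvg_ex; eexists; exact: cv.
  by apply: nearW => n; exact: Fge.
rewrite FK => h.
have : (nu K <= nu A)%E by apply: le_measure; rewrite ?inE.
rewrite nuA0 => /(le_trans h); rewrite lee_fin leNgt mulr_gt0//; lra.
Qed.

End TangentEquivalence.

(** * The digits *)

Section Digits.
Variable R : realType.

(** An integer larger than [e], so that exponentials can be compared with integer powers. *)
Definition exp_base : nat := (Num.truncn (expR (1 : R))).+1.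

(** The inverse of the half-width of the flat bottom of the well.  It tends to infinity, but so
slowly that [exp (- depth k) / depth k] is at least a constant times [1 / k]. *)
Definition depth (k : nat) : nat := (4 + trunc_log (2 * exp_base) k.+1)%N.

(** The number of children in one sixteenth of the half-width of the bottom of the well.  The
factor [depth k * k.+2 ^ 2 * 2 ^ k.+1] makes the weights of digits at distance at most
[k.+2 ^ 2] agree up to the factor [exp (2 ^- k.+1)]. *)
Definition resolution (k : nat) : nat := (depth k * k.+2 ^ 2 * 2 ^ k.+1)%N.

Definition arity (k : nat) : nat := (16 * depth k * resolution k)%N.

Definition cutoff (k : nat) : R := (depth k)%:R^-1.

Fixpoint cell_length (k : nat) : R :=
  if k is k'.+1 then cell_length k' / (arity k')%:R else 1.

Definition weight (k : nat) (j : int) : R := well R (cutoff k) (j%:~R / (arity k)%:R).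

Definition total_weight (k : nat) : R := \sum_(0 <= d < arity k) weight k d%:Z.

Fixpoint cell_mass (k : nat) (j : int) : R :=
  if k is k'.+1 then
    cell_mass k' (j %/ (arity k')%:Z)%Z * (weight k' j / total_weight k')
  else 1.

Lemma depth_ge4 k : (4 <= depth k)%N. Proof. exact: leq_addr. Qed.

Lemma depth_gt0 k : (0 < depth k)%N. Proof. exact: leq_trans (depth_ge4 k). Qed.

Lemma resolution_gt0 k : (0 < resolution k)%N.
Proof. by rewrite !muln_gt0 depth_gt0 !expn_gt0. Qed.

Lemma arity_gt0 k : (0 < arity k)%N.
Proof. by rewrite /arity muln_gt0 resolution_gt0 muln_gt0 depth_gt0. Qed.

Lemma arityR_gt0 k : 0 < (arity k)%:R :> R.
Proof. by rewrite ltr0n arity_gt0. Qed.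

Lemma arity_ge k : (16 * k.+2 ^ 2 <= arity k)%N.
Proof.
rewrite /arity /resolution -mulnA leq_mul2l/=.
apply: leq_trans (leq_pmull _ (depth_gt0 k)).
by rewrite mulnC mulnA leq_pmull// muln_gt0 expn_gt0 depth_gt0.
Qed.

Lemma cutoff_gt0 k : 0 < cutoff k.
Proof. by rewrite invr_gt0 ltr0n depth_gt0. Qed.

Lemma cutoff_le14 k : cutoff k <= 1/4.
Proof.
by rewrite /cutoff div1r lef_pV2 ?posrE ?ltr0n ?depth_gt0// ler_nat depth_ge4.
Qed.

Lemma cell_length_gt0 k : 0 < cell_length k.
Proof. by elim: k => //= k IH; rewrite divr_gt0 ?arityR_gt0. Qed.

Lemma cell_lengthS k : cell_length k = cell_length k.+1 * (arity k)%:R.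
Proof. by rewrite /= divfK// gt_eqF// arityR_gt0. Qed.

Lemma weight_gt0 k j : 0 < weight k j. Proof. exact: well_gt0. Qed.

Lemma weight_le k j j' (s : nat) : `|j - j'| <= s%:Z -> (s <= k.+2 ^ 2)%N ->
  weight k j <= expR (2 ^- k.+1) * weight k j'.
Proof.
move=> jj' sk; apply: le_trans (well_lip _ _ _ (j'%:~R / (arity k)%:R) (cutoff_gt0 k)) _.
rewrite ler_pM2r ?weight_gt0// ler_expR.
rewrite -mulrBl normrM (@ger0_norm _ (_^-1)); last by rewrite invr_ge0.
rewrite -intrB -intr_norm /cutoff exprVn invrK.
apply: (@le_trans _ _ (s%:R / (arity k)%:R * (depth k)%:R ^+ 2)).
  rewrite ler_wpM2r ?exprn_ge0// ler_wpM2r ?invr_ge0//.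
  by rewrite -[s%:R]/(s%:Z%:~R) ler_int.
rewrite mulrAC ler_pdivrMr ?arityR_gt0//.
rewrite -(@ler_pM2l _ (2 ^+ k.+1)) ?exprn_gt0// [leRHS]mulrA mulfV ?mul1r;
  last by rewrite expf_neq0.
rewrite -!natrX -!natrM ler_nat /arity /resolution.
apply: (@leq_trans (2 ^ k.+1 * (k.+2 ^ 2 * depth k ^ 2))).
  by rewrite !leq_mul.
have -> : (16 * depth k * (depth k * k.+2 ^ 2 * 2 ^ k.+1) = 16 * (2 ^ k.+1 * (k.+2 ^ 2 * depth
  k ^ 2)))%N.
  by rewrite -mulnn; ring.
exact: leq_pmull.
Qed.

Lemma weightDM k (i j : int) : weight k (i * (arity k)%:Z + j) = weight k j.
Proof.
rewrite /weight intrD intrM mulrDl -[(arity k)%:Z%:~R]/((arity k)%:R) mulfK ?gt_eqF ?arityR_gt0//.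
by rewrite addrC wellDz.
Qed.

Lemma weight_modz k j : weight k (j %% (arity k)%:Z)%Z = weight k j.
Proof. by rewrite [in RHS](divz_eq j (arity k)%:Z) weightDM. Qed.

(** A digit has a neighbour of almost the same weight, hence a probability that stays
away from 1. *)
Lemma weight_le_total k (d : nat) : (d < arity k)%N ->
  (1 + expR 1) * weight k d%:Z <= expR 1 * total_weight k.
Proof.
move=> dN; have N2 : (1 < arity k)%N by apply: leq_trans (arity_ge k);
  rewrite (@leq_mul 2 1)// expn_gt0.
pose d' := if d is d0.+1 then d0 else 1%N.
have d'N : (d' < arity k)%N by rewrite /d'; case: (d) dN => // d0 /ltnW.
have dd' : d' != d by rewrite /d'; case: (d) => // d0; rewrite neq_ltn ltnSn.
have h : weight k d%:Z + weight k d'%:Z <= total_weight k.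
  rewrite /total_weight big_mkord (bigD1 (Ordinal dN))//= lerD2l.
  rewrite (bigD1 (Ordinal d'N))//= lerDl sumr_ge0// => i _.
  exact/ltW/weight_gt0.
have h' : weight k d%:Z <= expR 1 * weight k d'%:Z.
  apply: le_trans (weight_le k d%:Z d'%:Z 1 _ _) _.
  - by rewrite /d'; case: (d) => // d0; lia.
  - by rewrite expn_gt0.
  - rewrite ler_pM2r ?weight_gt0// ler_expR invf_le1 ?exprn_gt0//.
    by rewrite exprn_ege1// ler1n.
have e0 := expR_gt0 (1 : R); nra.
Qed.

Lemma total_weight_gt0 k : 0 < total_weight k.
Proof.
have := weight_le_total k 0 (arity_gt0 k).
have := weight_gt0 k 0; have := expR_gt0 (1 : R) => e0 w0 h.
rewrite -(pmulr_rgt0 _ e0); apply: lt_le_trans h.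
by rewrite mulr_gt0// addr_gt0.
Qed.

Lemma cell_mass_gt0 k j : 0 < cell_mass k j.
Proof.
elim: k j => //= k IH j; rewrite mulr_gt0//.
by rewrite divr_gt0 ?weight_gt0 ?total_weight_gt0.
Qed.

Lemma cell_massDM k (i : int) (d : nat) : (d < arity k)%N ->
  cell_mass k.+1 (i * (arity k)%:Z + d%:Z) = cell_mass k i * (weight k d%:Z / total_weight k).
Proof.
move=> dN; rewrite /= weightDM divzMDl ?divz_small ?addr0//.
by have := arity_gt0 k; lia.
Qed.

Lemma cell_mass_refine k i :
  cell_mass k i = \sum_(0 <= d < arity k) cell_mass k.+1 (i * (arity k)%:Z + d%:Z).
Proof.
under eq_big_nat => d /andP[_ dN] do rewrite cell_massDM//.
by rewrite -mulr_sumr -mulr_suml -/(total_weight k) divff ?mulr1// gt_eqF// total_weight_gt0.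
Qed.

Lemma divz_near (j j' : int) (N s : nat) : (0 < N)%N -> (s <= N)%N -> `|j - j'| <= s%:Z ->
  `|(j %/ N%:Z)%Z - (j' %/ N%:Z)%Z| <= 1.
Proof.
move=> N0 sN h.
have := divz_eq j N%:Z; have := divz_eq j' N%:Z.
have := modz_ge0 j (_ : N%:Z != 0); have := modz_ge0 j' (_ : N%:Z != 0).
have := ltz_pmod j (_ : 0 < N%:Z); have := ltz_pmod j' (_ : 0 < N%:Z).
move: (j %/ N%:Z)%Z (j' %/ N%:Z)%Z (j %% N%:Z)%Z (j' %% N%:Z)%Z => q q' r r'.
move=> /(_ N0) a1 /(_ N0) a2 /(_ (ltac:(lia))) a3 /(_ (ltac:(lia))) a4 a5 a6.
nia.
Qed.

(** Cells of the same stage that are close have parents that are equal or adjacent, so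
the logarithmic errors of all the previous stages accumulate; they are summable. *)
Lemma cell_mass_near k (i i' : int) : `|i - i'| <= (k.+1 ^ 2)%N%:Z ->
  cell_mass k i <= expR (1 - 2 ^- k) * cell_mass k i'.
Proof.
elim: k i i' => [|k IH] j j' h.
  by rewrite /= expr0 invr1 subrr expR0 mul1r.
rewrite /=; set N := (arity k)%:Z.
have hN : (k.+2 ^ 2 <= arity k)%N by apply: leq_trans (arity_ge k); exact: leq_pmull.
have /IH h1 : `|(j %/ N)%Z - (j' %/ N)%Z| <= (k.+1 ^ 2)%N%:Z.
  apply: le_trans (divz_near _ _ _ _ (arity_gt0 k) hN h) _.
  by rewrite lez_nat expn_gt0.
have h2 := weight_le k j j' _ h (leqnn _).
have -> : 1 - 2 ^- k.+1 = (1 - 2 ^- k) + 2 ^- k.+1 :> R.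
  rewrite exprS invfM; lra.
rewrite expRD mulrACA; apply: ler_pM => //.
- exact/ltW/cell_mass_gt0.
- by rewrite ltW// divr_gt0 ?weight_gt0 ?total_weight_gt0.
- by rewrite mulrA ler_pM2r// invr_gt0 total_weight_gt0.
Qed.

Lemma cell_mass_comparable k (i i' : int) : `|i - i'| <= (k.+1 ^ 2)%N%:Z ->
  cell_mass k i <= expR 1 * cell_mass k i'.
Proof.
move=> /cell_mass_near /le_trans; apply; rewrite ler_pM2r ?cell_mass_gt0// ler_expR.
by rewrite gerBl invr_ge0 exprn_ge0.
Qed.

Lemma cell_mass_le k j : cell_mass k j <= (expR 1 / (1 + expR 1)) ^+ k.
Proof.
have e0 := expR_gt0 (1 : R).
elim: k j => // k IH j; rewrite exprSr; apply: ler_pM => //.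
- exact/ltW/cell_mass_gt0.
- by rewrite ltW// divr_gt0 ?weight_gt0 ?total_weight_gt0.
rewrite ler_pdivrMr ?total_weight_gt0// mulrAC ler_pdivlMr; last by rewrite addr_gt0.
rewrite mulrC -weight_modz.
have N0 : 0 < (arity k)%:Z by rewrite ltz_nat arity_gt0.
have := ltz_pmod j N0; have := modz_ge0 j (lt0r_neq0 N0).
case: (j %% _)%Z => // d _; rewrite ltz_nat; exact: weight_le_total.
Qed.

Lemma cell_mass_small e : 0 < e ->
  exists K, forall k i, (K <= k)%N -> cell_mass k i <= e.
Proof.
move=> e0; have e10 := expR_gt0 (1 : R).
have : `|expR 1 / (1 + expR 1)| < 1 :> R.
  rewrite ger0_norm; last by rewrite divr_ge0// ltW// addr_gt0.
  by rewrite ltr_pdivrMr ?addr_gt0// mul1r ltrDr.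
move=> /cvg_expr /cvgrPdist_lt /(_ e e0) [K _ hK]; exists K => k i Kk.
apply: le_trans (cell_mass_le k i) _.
have := hK k Kk; rewrite /= sub0r normrN => /ltW; apply: le_trans.
exact: ler_norm.
Qed.

Lemma measure_of_digits : exists mu : {measure set (measurableTypeR R) -> \bar R},
  forall k i, mu `]i%:~R * cell_length k, (i + 1)%:~R * cell_length k]%classic = (cell_mass k
    i)%:E.
Proof.
apply: (mass_distribution R arity).
- exact: cell_length_gt0.
- exact: cell_lengthS.
- by move=> k i; exact/ltW/cell_mass_gt0.
- exact: cell_mass_refine.
- exact: cell_mass_small.
Qed.

(** Below [scale k] a magnification shows at most about [k] cells of stage [k] per unit of
length; above [scale k.+1] it shows the cells of stage [k.+1] as small. *)
Definition scale (k : nat) : R := k.+1%:R * cell_length k.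

Lemma scaleS_le k : scale k.+1 <= scale k / 2.
Proof.
rewrite /scale/= mulrA [leLHS]mulrAC [leRHS]mulrAC ler_pM2r ?cell_length_gt0//.
have h : (k.+2%:R <= 2^-1 * (arity k)%:R :> R).
  rewrite mulrC ler_pdivlMr// -natrM ler_nat; apply: leq_trans (arity_ge k).
  by rewrite mulnC leq_mul// (@leq_pexp2l k.+2 1).
rewrite ler_pdivrMr ?arityR_gt0//; apply: le_trans h _.
by rewrite -mulrA ler_peMl ?ler1n// mulr_ge0// invr_ge0.
Qed.

Lemma scale_gt0 k : 0 < scale k.
Proof. by rewrite mulr_gt0 ?cell_length_gt0. Qed.

Lemma scale_le k : scale k <= 2 ^- k.
Proof.
elim: k => [|k IH]; first by rewrite /scale/= expr0 invr1 mulr1.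
by rewrite exprS invfM mulrC; apply: le_trans (scaleS_le k) _; rewrite ler_pM2r.
Qed.

Lemma scale_mono : {homo scale : k k' / (k <= k')%N >-> k' <= k}.
Proof.
apply: homo_leq => [//|y x z xy yz|k]; first exact: le_trans yz xy.
by apply: le_trans (scaleS_le k) _; have := scale_gt0 k; lra.
Qed.

(** Every small scale lies in one of the bands [scale k.+1 <= r < scale k], with [k] large. *)
Lemma scale_band r K : 0 < r -> r < scale K ->
  exists k, [/\ (K <= k)%N, scale k.+1 <= r & r < scale k].
Proof.
move=> r0 rK; have ex : exists k, scale k <= r.
  have : `|2^-1| < 1 :> R by rewrite ger0_norm// invf_lt1// ltr1n.
  move=> /cvg_expr /cvgrPdist_lt /(_ r r0) [n _ hn]; exists n.
  apply: le_trans (scale_le n) _; have := hn n (leqnn n).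
  rewrite /= sub0r normrN exprVn ger0_norm ?invr_ge0 ?exprn_ge0//; exact: ltW.
case: (ex_minnP ex) => -[|k] kr kmin.
  by have := scale_mono _ _ (leq0n K); move=> /= h; have := lt_le_trans rK (le_trans h kr);
    rewrite ltxx.
exists k; split=> //; last by rewrite ltNge; apply/negP => /kmin; rewrite ltnn.
rewrite leqNgt; apply/negP => kK.
by have := lt_le_trans rK (le_trans (scale_mono _ _ kK) kr); rewrite ltxx.
Qed.

End Digits.

(** * Magnifications of the digit measure *)

Lemma divz_bounds (j : int) (N : nat) : (0 < N)%N ->
  (j %/ N%:Z)%Z * N%:Z <= j /\ j + 1 <= ((j %/ N%:Z)%Z + 1) * N%:Z.
Proof.
move=> N0; have NZ : 0 < N%:Z by rewrite ltz_nat.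
have := divz_eq j N%:Z; have := modz_ge0 j (lt0r_neq0 NZ); have := ltz_pmod j NZ.
move: (j %/ N%:Z)%Z (j %% N%:Z)%Z => q s; lia.
Qed.

Section MagnifiedWindows.
Variable R : realType.
Notation mble := (measurableTypeR R).
Implicit Types (x c r W y : R).

Lemma rescaling_measure (mu : {measure set mble -> \bar R}) x c r : 0 < c ->
  exists m : {measure set mble -> \bar R}, (m : set mble -> \bar R) = rescaling mu x c r.
Proof.
move=> c0.
have mf : measurable_fun [set: mble] (magnify x r : mble -> mble).
  by rewrite /magnify; apply: measurable_funM => //; exact: measurable_funB.
unshelve (eexists (mscale (NngNum (ltW c0)) (pushforward mu (magnify x r : mble -> mble)))) => //.
Qed.

Variable mu : {measure set mble -> \bar R}.
Hypothesis mu_cell : forall k i,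
  mu `]i%:~R * cell_length R k, (i + 1)%:~R * cell_length R k]%classic = (cell_mass R k i)%:E.

(** A window of radius [W * r] with [r < scale k] meets at most [(k + 1) ^ 2] cells of
stage [k] when [k] is large compared with [W]; this is the range in which cell masses
are comparable. *)
Lemma ancestor_near k W r x (j j' : int) (y y' : R) : 0 < r -> r < scale R k ->
  2 * W + 1 <= k.+1%:R -> `|y| <= W -> `|y'| <= W ->
  j%:~R * cell_length R k < x + r * y <= (j + 1)%:~R * cell_length R k ->
  j'%:~R * cell_length R k < x + r * y' <= (j' + 1)%:~R * cell_length R k ->
  `|j - j'| <= (k.+1 ^ 2)%N%:Z.
Proof.
move=> r0 rs Wk yW y'W /andP[h1 h2] /andP[h3 h4].
have l0 := cell_length_gt0 R k.
have W0 : 0 <= W by apply: le_trans yW.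
have d1 : `|r * y - r * y'| <= 2 * W * r.
  rewrite -mulrBr normrM gtr0_norm//.
  have : `|y - y'| <= 2 * W by apply: le_trans (ler_normB _ _) _; lra.
  nra.
have d2 : 2 * W * r <= 2 * W * k.+1%:R * cell_length R k.
  by rewrite -[leRHS]mulrA ler_wpM2l ?mulr_ge0// ltW.
have d3 : `|j%:~R - j'%:~R| < 2 * W * k.+1%:R + 1 :> R.
  rewrite -(ltr_pM2r l0) -[X in _ * X < _](gtr0_norm l0) -normrM.
  move: d1 h1 h2 h3 h4; rewrite !intrD !mulrDl !mul1r !ler_norml ltr_norml =>
    /andP[a1 a2] h1 h2 h3 h4.
  by apply/andP; split; lra.
have k1 : 1 <= k.+1%:R :> R by rewrite ler1n.
have : `|j - j'|%:~R <= (k.+1 ^ 2)%N%:R :> R.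
  rewrite intr_norm intrB natrX; apply/ltW/(lt_le_trans d3).
  nra.
by rewrite -[(_ ^ _)%N%:R]/((k.+1 ^ 2)%N%:Z%:~R) ler_int.
Qed.

(** Inside the window, the mass of a cell of stage [k.+1] is the mass of its parent, which
is nearly constant, times the weight of its digit, which is nearly the value of
the well at any of its points. *)
Lemma magnified_window k W x c r (m : {measure set mble -> \bar R}) : 0 < W ->
  2 * W + 1 <= k.+1%:R -> 0 < c -> 0 < r -> r < scale R k ->
  (m : set mble -> \bar R) = rescaling mu x c r ->
  exists2 a, 0 < a & well_window R m (cell_length R k.+1 / r) a
    (x / cell_length R k) (r / cell_length R k) (cutoff R k) W.
Proof.
move=> W0 Wk c0 r0 rs mE.
set l := cell_length R k; set l' := cell_length R k.+1; set N : R := (arity R k)%:R.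
have l0 : 0 < l := cell_length_gt0 R k.
have l'0 : 0 < l' := cell_length_gt0 R k.+1.
have N0 : 0 < N := arityR_gt0 R k.
have lE : l = l' * N := cell_lengthS R k.
have Z0 := total_weight_gt0 R k.
pose i0 := Num.ceil (x / l) - 1.
have i0P : i0%:~R * l < x + r * 0 <= (i0 + 1)%:~R * l.
  have /andP[h1 h2] := ceil_itv (x / l).
  by rewrite mulr0 addr0 /i0 subrK -ltr_pdivlMr// h1/= -ler_pdivrMr.
pose j0 := Num.floor ((x - W * r) / l') - 1.
have w0 : 0 < l' / r by rewrite divr_gt0.
pose a := c * cell_mass R k i0 / total_weight R k / (l' / r).
exists a.
  by rewrite /a divr_gt0// divr_gt0// mulr_gt0// cell_mass_gt0.
exists ((j0%:~R * l' - x) / r).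
  rewrite ltr_pdivrMr// ltrBlDr mulNr addrC -ltr_pdivlMr//.
  apply: lt_le_trans (floor_le _); by rewrite /j0 intrD intrN gtrBl.
move=> n y ny yW; pose j := j0 + n%:Z.
have cE : magnify x r @^-1` cell R ((j0%:~R * l' - x) / r) (l' / r) n =
    `]j%:~R * l', (j + 1)%:~R * l']%classic.
  apply/seteqP; rewrite /magnify/cell/j; split=> Y; rewrite /= !in_itv/=;
  rewrite !mulrA -!mulrDl ltr_pM2r ?invr_gt0// ler_pM2r ?invr_gt0//;
  rewrite !intrD -natr1 => /andP[h1 h2]; apply/andP; split; lra.
have mn : m (cell R ((j0%:~R * l' - x) / r) (l' / r) n) = (c * cell_mass R k.+1 j)%:E.
  by rewrite mE /rescaling /pushforward cE mu_cell.
have Yj : j%:~R * l' < x + r * y <= (j + 1)%:~R * l'.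
  have : (magnify x r @^-1` cell R ((j0%:~R * l' - x) / r) (l' / r) n) (x + r * y).
    have My : magnify x r (x + r * y) = y by rewrite /magnify addrAC subrr add0r mulrC mulKf//
      gt_eqF.
    by rewrite /preimage/= My.
  by rewrite cE /= in_itv.
pose i := (j %/ (arity R k)%:Z)%Z.
have Yi : i%:~R * l < x + r * y <= (i + 1)%:~R * l.
  have [b1 b2] := divz_bounds j _ (arity_gt0 R k).
  have j1 : i%:~R * N <= j%:~R.
    by rewrite -[N]/((arity R k)%:Z%:~R) -intrM ler_int.
  have j2 : (j + 1)%:~R <= (i + 1)%:~R * N.
    by rewrite -[N]/((arity R k)%:Z%:~R) -intrM ler_int.
  move: Yj => /andP[g1 g2]; rewrite lE; apply/andP; split.
    by apply: le_lt_trans g1; rewrite [l' * N]mulrC mulrA ler_pM2r.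
  by apply: le_trans g2 _; rewrite [leRHS](_ : _ = (i + 1)%:~R * N * l') ?ler_pM2r//; ring.
have near1 : cell_mass R k i <= expR 1 * cell_mass R k i0.
  apply: cell_mass_comparable; apply: (ancestor_near k W r x i i0 y 0) => //;
    by rewrite normr0 ltW.
have near2 : cell_mass R k i0 <= expR 1 * cell_mass R k i.
  apply: cell_mass_comparable; apply: (ancestor_near k W r x i0 i 0 y) => //;
    by rewrite normr0 ltW.
set Y := x / l + r / l * y.
have YE : Y = (x + r * y) / l by rewrite /Y; ring.
have Yd : `|Y - j%:~R / N| <= N^-1.
  rewrite YE lE; move: Yj => /andP[g1 g2].
  have -> : (x + r * y) / (l' * N) - j%:~R / N = (x + r * y - j%:~R * l') / (l' * N).
    by field; rewrite !gt_eqF.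
  have lN0 : 0 < (l' * N)^-1 by rewrite invr_gt0 mulr_gt0.
  have -> : N^-1 = l' / (l' * N) by field; rewrite !gt_eqF.
  rewrite normrM (gtr0_norm lN0) ler_pM2r//.
  rewrite intrD mulrDl mul1r in g2.
  by rewrite ler_norml; apply/andP; split; lra.
have Nbig : N^-1 / cutoff R k ^+ 2 <= 1.
  rewrite /cutoff exprVn invrK mulrC ler_pdivrMr// mul1r -natrX ler_nat.
  rewrite /arity /resolution.
  rewrite (_ : (16 * depth R k * (depth R k * k.+2 ^ 2 * 2 ^ k.+1) = (16 * (k.+2 ^ 2 * 2 ^
    k.+1)) * depth R k ^ 2)%N); last first.
    by rewrite -[(depth R k ^ 2)%N]mulnn; ring.
  by apply: leq_pmull; rewrite !muln_gt0 !expn_gt0.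
have wn1 : weight R k j <= expR 1 * well R (cutoff R k) Y.
  apply: le_trans (well_lip _ _ _ Y (cutoff_gt0 R k)) _.
  rewrite ler_pM2r ?well_gt0// ler_expR; apply: le_trans Nbig.
  rewrite ler_pM2r ?invr_gt0 ?exprn_gt0 ?cutoff_gt0//; rewrite distrC; exact: Yd.
have wn2 : well R (cutoff R k) Y <= expR 1 * weight R k j.
  apply: le_trans (well_lip _ _ _ (j%:~R / N) (cutoff_gt0 R k)) _.
  rewrite ler_pM2r ?well_gt0// ler_expR; apply: le_trans Nbig.
  by rewrite ler_pM2r ?invr_gt0 ?exprn_gt0 ?cutoff_gt0.
have g0 := well_gt0 R (cutoff R k) Y; have wt0 := weight_gt0 R k j.
have M0 := cell_mass_gt0 R k i; have M00 := cell_mass_gt0 R k i0.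
have aE : a * well R (cutoff R k) Y * (l' / r) = c / total_weight R k * (cell_mass R k i0 *
  well R (cutoff R k) Y).
  by rewrite /a; field; rewrite !gt_eqF.
have mE' : c * cell_mass R k.+1 j = c / total_weight R k * (cell_mass R k i * weight R k j).
  by rewrite /= -/i; ring.
have cZ : 0 < c / total_weight R k by rewrite divr_gt0.
have e20 : expR 2 = expR 1 * expR 1 :> R by rewrite -expRD; congr expR; lra.
have E2 q : q * (a * well R (cutoff R k) Y) * (l' / r) =
    q * (c / total_weight R k * (cell_mass R k i0 * well R (cutoff R k) Y)).
  by rewrite -aE -[LHS]mulrA.
split; rewrite mn -/Y E2 lee_fin mE'.
  rewrite expRN ler_pdivrMl ?expR_gt0// [leRHS]mulrCA ler_pM2l// e20 mulrACA.
  by apply: ler_pM => //; exact: ltW.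
rewrite [leRHS]mulrCA ler_pM2l// e20 mulrACA.
by apply: ler_pM => //; exact: ltW.
Qed.

Lemma eventually_windows x (c r : nat -> R) (m_ : nat -> {measure set mble -> \bar R}) :
  (forall i, 0 < c i) -> (forall i, 0 < r i) -> r @ \oo --> (0 : R) ->
  (forall i, (m_ i : set mble -> \bar R) = rescaling mu x (c i) (r i)) ->
  forall W u : R, 0 < W -> 0 < u -> \forall i \near \oo,
  exists w a z rho e : R, [/\ 0 < w, w <= u, 0 < a, 0 < rho & 0 < e /\ e <= 1/4 /\
    well_window R (m_ i) w a z rho e W].
Proof.
move=> c0 r0 rlim mE W u W0 u0.
pose K := maxn (Num.truncn (2 * W + 1)) (Num.truncn u^-1).
near=> i.
have riK : r i < scale R K.
  near: i; have := scale_gt0 R K; move/cvgrPdist_lt: rlim => h /h.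
  apply: filterS => i /=; rewrite sub0r normrN gtr0_norm//.
have [k [Kk kr rk]] := scale_band R (r i) K (r0 i) riK.
have k1 : 2 * W + 1 <= k.+1%:R.
  apply: ltW; apply: lt_le_trans (truncnS_gt _) _; rewrite ler_nat ltnS.
  by apply: leq_trans Kk; exact: leq_maxl.
have k2 : u^-1 <= k.+1%:R.
  apply: ltW; apply: lt_le_trans (truncnS_gt _) _; rewrite ler_nat ltnS.
  by apply: leq_trans Kk; exact: leq_maxr.
have [a a0 win] := magnified_window k W x (c i) (r i) (m_ i) W0 k1 (c0 i) (r0 i) rk (mE i).
exists (cell_length R k.+1 / r i), a, (x / cell_length R k), (r i / cell_length R k),
  (cutoff R k).
split=> //.
- by rewrite divr_gt0// cell_length_gt0.
- rewrite ler_pdivrMr//; apply: le_trans (_ : u * scale R k.+1 <= _); last by rewrite ler_pM2l.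
  rewrite /scale mulrA ler_peMl//; first exact/ltW/cell_length_gt0.
  rewrite -ler_pdivrMl// mulr1; apply: le_trans k2 _; by rewrite ler_nat.
- by rewrite divr_gt0// cell_length_gt0.
- by split; [exact: cutoff_gt0|split; [exact: cutoff_le14|]].
Unshelve. all: by end_near. Qed.

End MagnifiedWindows.

(** * Almost every point has infinitely many deep digits *)

Section NonDoubling.
Variable R : realType.
Notation mble := (measurableTypeR R).
Variable mu : {measure set mble -> \bar R}.

Definition digit_cell k (i : int) : set mble :=
  `]i%:~R * cell_length R k, (i + 1)%:~R * cell_length R k]%classic.

Hypothesis mu_cell : forall k i, mu (digit_cell k i) = (cell_mass R k i)%:E.

(** The digits to the right of the centre of the well, at a distance between 10/16 and
12/16 of the half-width of its flat bottom. *)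
Definition deep (k d : nat) : bool := (10 * resolution R k <= d < 12 * resolution R k)%N.

Definition deep_points (k : nat) : set R := [set x | exists (i : int) (d : nat),
  deep k d /\ digit_cell k.+1 (i * (arity R k)%:Z + d%:Z) x].

Lemma digit_cell_measurable k i : measurable (digit_cell k i).
Proof. exact: measurable_itv. Qed.

Lemma digit_cellP k i (x : R) : digit_cell k i x <->
  i%:~R * cell_length R k < x <= (i + 1)%:~R * cell_length R k.
Proof.
rewrite /digit_cell; move: (cell_length R k) => l.
by split; rewrite /= in_itv.
Qed.

Lemma digit_cell_ex k (x : R) : exists i, digit_cell k i x.
Proof.
exists (Num.ceil (x / cell_length R k) - 1); apply/digit_cellP; rewrite subrK.
have /andP[h1 h2] := ceil_itv (x / cell_length R k).
by rewrite -ltr_pdivlMr ?cell_length_gt0// h1/= -ler_pdivrMr ?cell_length_gt0.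
Qed.

Lemma digit_cell_child k i (x : R) : digit_cell k i x ->
  exists2 d : nat, (d < arity R k)%N & digit_cell k.+1 (i * (arity R k)%:Z + d%:Z) x.
Proof.
have [j jx] := digit_cell_ex k.+1 x; have l0 := cell_length_gt0 R k.+1.
move: (jx) => /digit_cellP /andP[j1 j2] /digit_cellP.
have E a : a * cell_length R k = a * (arity R k)%:R * cell_length R k.+1.
  by rewrite (cell_lengthS R k); move: (cell_length R k.+1) => l'; ring.
rewrite !E => /andP[i1 i2].
have : i * (arity R k)%:Z < j + 1.
  by rewrite -(ltr_int R) intrM -(ltr_pM2r l0); exact: lt_le_trans i1 j2.
have : j < (i + 1) * (arity R k)%:Z.
  by rewrite -(ltr_int R) intrM -(ltr_pM2r l0); exact: lt_le_trans j1 i2.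
move=> h1 h2; have [d dE] := int_le_diff (i * (arity R k)%:Z) j (ltac:(lia)).
exists d; last by rewrite -dE.
by move: h1; rewrite dE mulrDl mul1r ltrD2l ltz_nat.
Qed.

(** The points of a cell of stage [K] whose next [m] digits are not deep.  The recursion on
the first of these digits turns independence into a product formula. *)
Fixpoint avoiding (m K : nat) (i : int) : set mble :=
  if m is m'.+1 then
    \big[setU/set0]_(0 <= d < arity R K | ~~ deep K d) avoiding m' K.+1 (i * (arity R K)%:Z +
      d%:Z)
  else digit_cell K i.

Lemma avoiding_measurable m K i : measurable (avoiding m K i).
Proof.
elim: m K i => [|m IH] K i; first exact: digit_cell_measurable.
by apply: bigsetU_measurable => d _; exact: IH.
Qed.

Lemma avoidingP m K i (x : R) : digit_cell K i x ->
  (forall k, (K <= k)%N -> ~ deep_points k x) -> avoiding m K i x.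
Proof.
elim: m K i => [|m IH] K i iK hx //=.
have [d dN dx] := digit_cell_child _ _ _ iK.
rewrite -bigcup_seq_cond; exists d.
  rewrite /= mem_index_iota dN/=; apply/negP => dd.
  by apply: (hx K) => //; exists i, d.
by apply: IH => // k Kk; apply: hx; exact: ltnW.
Qed.

Lemma measure_bigsetU_le (s : seq nat) (P : pred nat) (F : nat -> set mble) :
  (forall d, measurable (F d)) ->
  (mu (\big[setU/set0]_(d <- s | P d) F d) <= \sum_(d <- s | P d) mu (F d))%E.
Proof.
move=> mF; elim: s => [|d s IH]; first by rewrite !big_nil measure0.
rewrite !big_cons; case: ifP => // _.
apply: le_trans (measureU2 _ (mF d) _) _; first exact: bigsetU_measurable.
by rewrite leeD2l.
Qed.

(** The constant in the bound [rate / k.+1] on the probability of a deep digit. *)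
Definition rate : R := (8 * (2 * exp_base R) ^ 4)%:R^-1.

Lemma exp_base_gt k : expR k%:R <= (exp_base R ^ k)%:R :> R.
Proof.
rewrite -[k%:R]mulr1 expRM_natl natrX lerXn2r ?nnegrE ?expR_ge0//.
by rewrite ltW//; exact: truncnS_gt.
Qed.

(** These digits lie in the flat bottom of the well. *)
Lemma deep_weight k d : (d <= 16 * resolution R k)%N ->
  weight R k d%:Z = expR (- (depth R k)%:R).
Proof.
move=> dk; rewrite /weight/well/cutoff_dist.
have N0 := arityR_gt0 R k; have e0 : 0 < (depth R k)%:R :> R by rewrite ltr0n depth_gt0.
have dN : d%:Z%:~R / (arity R k)%:R <= cutoff R k.
  rewrite /cutoff ler_pdivrMr// mulrC ler_pdivlMr// -[d%:Z%:~R]/(d%:R) -natrM ler_nat.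
  rewrite /arity -mulnA [(depth R k * _)%N]mulnC mulnA leq_mul2r dk orbT//.
have c14 := cutoff_le14 R k.
rewrite dist_int_id; first by rewrite max_r// /cutoff invrK.
by rewrite divr_ge0//= ?ltW//; lra.
Qed.

(** At 17/16 of the half-width of the bottom, the well has already risen to
[exp (- 16/17 * depth)]. *)
Lemma shallow_weight k d : (17 * resolution R k <= d <= 18 * resolution R k)%N ->
  expR (- (16 / 17 * (depth R k)%:R)) <= weight R k d%:Z.
Proof.
move=> /andP[d1 d2].
have N0 := arityR_gt0 R k; have e0 : 0 < (depth R k)%:R :> R by rewrite ltr0n depth_gt0.
have e4 : 4 <= (depth R k)%:R :> R by rewrite ler_nat depth_ge4.
have r0 : 0 < (resolution R k)%:R :> R by rewrite ltr0n resolution_gt0.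
have NE : (arity R k)%:R = 16 * (depth R k)%:R * (resolution R k)%:R :> R by rewrite /arity
  !natrM.
have d1' : 17 * (resolution R k)%:R <= d%:R :> R by rewrite -natrM ler_nat.
have d2' : d%:R <= 18 * (resolution R k)%:R :> R by rewrite -natrM ler_nat.
have -> : - (16 / 17 * (depth R k)%:R) = - (17 / 16 / (depth R k)%:R)^-1 :> R.
  by field; rewrite gt_eqF.
apply: well_ge; [exact: cutoff_gt0|by rewrite !divr_gt0|].
rewrite dist_int_id.
  rewrite ler_pdivrMr// mulrAC ler_pdivlMr// NE -[d%:Z%:~R]/(d%:R).
  nra.
rewrite divr_ge0//= ?(ltW N0)// ler_pdivrMr// NE -[d%:Z%:~R]/(d%:R).
nra.
Qed.

(** Both [depth] and [exp depth] are at most powers of exponent [depth], which is a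
logarithm of [k.+1] in the product of the two bases, plus 4. *)
Lemma depth_exp_le k : (depth R k)%:R * expR (depth R k)%:R <= ((2 * exp_base R) ^ 4 *
  k.+1)%:R :> R.
Proof.
apply: (@le_trans _ _ (((2 * exp_base R) ^ depth R k)%N%:R)).
  rewrite expnMn natrM; apply: ler_pM; rewrite ?expR_ge0 ?exp_base_gt//.
  by rewrite ler_nat ltnW// ltn_expl.
rewrite ler_nat /depth expnD leq_mul2l trunc_logP ?orbT//.
by rewrite mulnS.
Qed.

Lemma total_weight_le k : total_weight R k <= (arity R k)%:R.
Proof.
rewrite /total_weight; apply: (@le_trans _ _ (\sum_(0 <= d < arity R k) 1)).
  by apply: ler_sum => d _; apply: well_le1; exact: cutoff_gt0.
by rewrite big_mkord sumr_const card_ord.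
Qed.

Lemma shallow_probability k :
  \sum_(0 <= d < arity R k | ~~ deep k d) (weight R k d%:Z / total_weight R k) <= expR (-
    (rate / k.+1%:R)).
Proof.
have Z0 := total_weight_gt0 R k; have N0 := arityR_gt0 R k.
have e0 : 0 < (depth R k)%:R :> R by rewrite ltr0n depth_gt0.
have r0 : 0 < (resolution R k)%:R :> R by rewrite ltr0n resolution_gt0.
apply: le_trans (expR_ge1Dx _).
rewrite -mulr_suml ler_pdivrMr//.
have -> : \sum_(0 <= d < arity R k | ~~ deep k d) weight R k d%:Z =
    total_weight R k - \sum_(0 <= d < arity R k | deep k d) weight R k d%:Z.
  by rewrite /total_weight [in RHS](bigID (deep k))/= addrAC subrr add0r.
have -> : \sum_(0 <= d < arity R k | deep k d) weight R k d%:Z =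
    2 * (resolution R k)%:R * expR (- (depth R k)%:R).
  have h10 : (10 * resolution R k <= 12 * resolution R k)%N by rewrite leq_mul2r orbT.
  have h12 : (12 * resolution R k <= arity R k)%N.
    rewrite /arity leq_mul2r; apply/orP; right.
    by apply: leq_trans (_ : 16 <= _)%N => //; rewrite leq_pmulr// depth_gt0.
  rewrite (eq_bigr (fun=> expR (- (depth R k)%:R))); last first.
    move=> d /andP[_ /ltnW d12]; apply: deep_weight; apply: leq_trans d12 _.
    by rewrite leq_mul2r orbT.
  rewrite -big_filter (_ : [seq d <- index_iota 0 (arity R k) | deep k d] =
      index_iota (10 * resolution R k) (12 * resolution R k)); last first.
    apply: (irr_sorted_eq ltn_trans ltnn); first by rewrite sorted_filter ?iota_ltn_sorted//;
      exact: ltn_trans.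
      exact: iota_ltn_sorted.
    move=> d; rewrite mem_filter !mem_index_iota leq0n/= /deep.
    case: (boolP (_ <= d < _)%N) => //= /andP[_ d12].
    exact: leq_trans d12 h12.
  rewrite big_const_seq count_predT size_iota iter_addr_0 -[LHS]mulr_natr mulrC; congr (_ * _).
  rewrite -natrM; congr (_%:R).
  by rewrite -mulnBl.
rewrite mulrBl mul1r lerD2l lerN2.
have dE := depth_exp_le k.
apply: (@le_trans _ _ (rate / k.+1%:R * (arity R k)%:R)).
  rewrite ler_wpM2l ?total_weight_le// divr_ge0//= invr_ge0//.
rewrite natrM in dE; rewrite /rate natrM expRN.
have -> : (arity R k)%:R = 16 * (depth R k)%:R * (resolution R k)%:R :> R by rewrite /arity
  !natrM.
have q0 : 0 < ((2 * exp_base R) ^ 4)%:R :> R by rewrite ltr0n expn_gt0.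
have ee0 := expR_gt0 ((depth R k)%:R : R).
have n0 := ltr0Sn R k.
move: (expR (depth R k)%:R) ee0 dE => e ee0 dE.
move: ((2 * exp_base R) ^ 4)%:R (depth R k)%:R (resolution R k)%:R k.+1%:R
  n0 q0 e0 r0 dE => q dep res n n0 q0 e0 r0 dE.
have -> : (8 * q)^-1 / n * (16 * dep * res) = 2 * res * (dep / (q * n)).
  by field; rewrite !gt_eqF.
rewrite ler_pM2l ?mulr_gt0// ler_pdivrMr ?mulr_gt0// ler_pdivlMl//.
by rewrite mulrC.
Qed.

Lemma avoiding_le m K i : (mu (avoiding m K i) <=
  (cell_mass R K i * expR (- (rate * \sum_(K <= k < K + m) k.+1%:R^-1)))%:E)%E.
Proof.
elim: m K i => [|m IH] K i.
  by rewrite addn0 big_geq// mulr0 oppr0 expR0 mulr1 [avoiding _ _ _]/= mu_cell.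
rewrite [avoiding _ _ _]/=; apply: le_trans (measure_bigsetU_le _ _ _ _) _.
  by move=> d; exact: avoiding_measurable.
pose S : R := \sum_(K.+1 <= k < K.+1 + m) k.+1%:R^-1.
have SE : \sum_(K <= k < K + m.+1) k.+1%:R^-1 = K.+1%:R^-1 + S :> R.
  by rewrite big_ltn ?addnS ?addSn// ltnS leq_addr.
apply: (@le_trans _ _ (\sum_(0 <= d < arity R K | ~~ deep K d)
    (cell_mass R K i * (weight R K d%:Z / total_weight R K) * expR (- (rate * S)))%:E)%E).
  rewrite big_seq_cond [leRHS]big_seq_cond; apply: lee_sum => d /andP[].
  rewrite mem_index_iota => /andP[_ dN] _.
  by have := IH K.+1 (i * (arity R K)%:Z + d%:Z); rewrite cell_massDM// -/S.
rewrite sumEFin lee_fin -mulr_suml -mulr_sumr -mulrA.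
rewrite ler_pM2l ?cell_mass_gt0// SE mulrDr opprD expRD.
rewrite ler_pM2r ?expR_gt0//; exact: shallow_probability.
Qed.

Lemma harmonic_tail K (A : R) : exists m, A <= \sum_(K <= k < K + m) k.+1%:R^-1.
Proof.
apply: contrapT => hn; apply: (@dvg_harmonic R).
apply: nondecreasing_is_cvgn.
  by apply/nondecreasing_seqP => n; rewrite /series/= big_nat_recr//= lerDl harmonic_ge0.
(* if all the tails were below [A], the harmonic series would be bounded *)
exists (\sum_(0 <= k < K) k.+1%:R^-1 + A) => _ [n _ <-].
rewrite /series/=; have [nK|/ltnW Kn] := leqP n K.
  apply: (@le_trans _ _ (\sum_(0 <= k < K) k.+1%:R^-1)).
    rewrite (big_cat_nat _ nK)//= lerDl sumr_ge0//.
  rewrite lerDl leNgt; apply/negP => A0; apply: hn; exists 0%N.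
  by rewrite addn0 big_geq// ltW.
rewrite (big_cat_nat _ Kn)//= lerD2l leNgt; apply/negP => h; apply: hn.
by exists (n - K)%N; rewrite subnKC// ltW.
Qed.

Lemma avoiding_null K i : mu (\bigcap_m avoiding m K i) = 0%E.
Proof.
have mI : measurable (\bigcap_m avoiding m K i).
  by apply: bigcapT_measurable => m; exact: avoiding_measurable.
apply/eqP; rewrite eq_le measure_ge0 andbT; apply/lee_addgt0Pr => e e0; rewrite add0e.
have r0 : 0 < rate by rewrite invr_gt0 ltr0n muln_gt0 expn_gt0.
have M0 := cell_mass_gt0 R K i.
have [m hm] := harmonic_tail K (cell_mass R K i / e / rate).
apply: (@le_trans _ _ (mu (avoiding m K i))).
  by apply: le_measure; rewrite ?inE//; [exact: avoiding_measurable|move=> x; apply].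
apply: le_trans (avoiding_le m K i) _; rewrite lee_fin expRN.
rewrite ler_pdivrMr ?expR_gt0// [leRHS]mulrC -ler_pdivrMr//.
rewrite ler_pdivrMr// [leRHS]mulrC in hm.
apply: le_trans hm _; apply: le_trans (expR_ge1Dx _).
by rewrite lerDr.
Qed.

Lemma eventually_shallow_negligible :
  mu.-negligible [set x | exists K, forall k, (K <= k)%N -> ~ deep_points k x].
Proof.
apply: (@negligibleS _ _ _ mu (\bigcup_K \bigcup_n
  (\bigcap_m avoiding m K (odflt 0 (unpickle n : option int))))).
  move=> x [K hK]; exists K => //; have [i ix] := digit_cell_ex K x.
  by exists (pickle i) => // m _; rewrite pickleK/=; exact: avoidingP.
apply: negligible_bigcup => K; apply: negligible_bigcup => n.
apply/negligibleP; last exact: avoiding_null.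
by apply: bigcapT_measurable => m; exact: avoiding_measurable.
Qed.

End NonDoubling.

(** * Ratios at deep digits and the theorem *)

Section DeepRatio.
Variable R : realType.
Notation mble := (measurableTypeR R).
Variable mu : {measure set mble -> \bar R}.
Hypothesis mu_cell : forall k i, mu (digit_cell R k i) = (cell_mass R k i)%:E.

Definition digit_range k (j : int) (n : nat) : set mble :=
  `]j%:~R * cell_length R k, (j + n%:Z)%:~R * cell_length R k]%classic.

Lemma digit_rangeP k j n (x : R) : digit_range k j n x <->
  j%:~R * cell_length R k < x <= (j + n%:Z)%:~R * cell_length R k.
Proof.
rewrite /digit_range; move: (cell_length R k) => l.
by split; rewrite /= in_itv.
Qed.

Lemma digit_range_measurable k j n : measurable (digit_range k j n).
Proof. exact: measurable_itv. Qed.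

Lemma digit_range_measure k j n :
  mu (digit_range k j n) = (\sum_(0 <= t < n) cell_mass R k (j + t%:Z))%:E.
Proof.
have l0 := cell_length_gt0 R k.
elim: n => [|n IH].
  rewrite big_geq// /digit_range addr0 set_itv_ge ?measure0//.
  by rewrite bnd_simp ltxx.
have -> : digit_range k j n.+1 = digit_range k j n `|` digit_cell R k (j + n%:Z).
  have E : (j + n.+1%:Z)%:~R = (j + n%:Z + 1)%:~R :> R by congr (_%:~R); lia.
  have le1 : j%:~R * cell_length R k <= (j + n%:Z)%:~R * cell_length R k.
    by rewrite ler_pM2r// ler_int lerDl.
  have le2 : (j + n%:Z)%:~R * cell_length R k <= (j + n%:Z + 1)%:~R * cell_length R k.
    by rewrite ler_pM2r// ler_int lerDl.
  apply/seteqP; split=> x.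
    move=> /digit_rangeP; rewrite E => /andP[h1 h2].
    have [h|h] := leP x ((j + n%:Z)%:~R * cell_length R k).
      by left; apply/digit_rangeP; rewrite h1.
    by right; apply/digit_cellP; rewrite h h2.
  case=> [/digit_rangeP/andP[h1 h2]|/digit_cellP/andP[h1 h2]]; apply/digit_rangeP; rewrite E.
    by rewrite h1 (le_trans h2).
  by rewrite (le_lt_trans le1).
rewrite measureU; first by rewrite [X in (X + _)%E]IH [X in (_ + X)%E]mu_cell -EFinD big_nat_recr.
- exact: digit_range_measurable.
- exact: digit_cell_measurable.
- rewrite -subset0 => x [/digit_rangeP/andP[_ h1] /digit_cellP/andP[h2 _]].
  by have := lt_le_trans h2 h1; rewrite ltxx.
Qed.

Lemma digit_range_child_le k i (p q : nat) (c : R) : (p + q <= arity R k)%N ->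
  (forall d : nat, (p <= d < p + q)%N -> weight R k d%:Z <= c) ->
  (mu (digit_range k.+1 (i * (arity R k)%:Z + p%:Z) q) <=
   (q%:R * (cell_mass R k i * (c / total_weight R k)))%:E)%E.
Proof.
move=> pq hc; rewrite digit_range_measure lee_fin.
apply: (@le_trans _ _ (\sum_(0 <= t < q) (cell_mass R k i * (c / total_weight R k)))).
  rewrite big_seq_cond [leRHS]big_seq_cond; apply: ler_sum => t;
    rewrite mem_index_iota andbT => /andP[_ tq].
  rewrite -addrA -PoszD cell_massDM; last by apply: leq_trans pq; rewrite ltn_add2l.
  rewrite ler_pM2l ?cell_mass_gt0// ler_pM2r ?invr_gt0 ?total_weight_gt0//.
  by apply: hc; rewrite leq_addr ltn_add2l.
by rewrite big_mkord sumr_const card_ord [leRHS]mulr_natl.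
Qed.

Lemma digit_range_child_ge k i (p q : nat) (c : R) : (p + q <= arity R k)%N ->
  (forall d : nat, (p <= d < p + q)%N -> c <= weight R k d%:Z) ->
  ((q%:R * (cell_mass R k i * (c / total_weight R k)))%:E <=
   mu (digit_range k.+1 (i * (arity R k)%:Z + p%:Z) q))%E.
Proof.
move=> pq hc; rewrite digit_range_measure lee_fin.
apply: (@le_trans _ _ (\sum_(0 <= t < q) (cell_mass R k i * (c / total_weight R k)))).
  by rewrite big_mkord sumr_const card_ord [leLHS]mulr_natl.
rewrite big_seq_cond [leRHS]big_seq_cond; apply: ler_sum => t; rewrite mem_index_iota andbT =>
  /andP[_ tq].
rewrite -addrA -PoszD cell_massDM; last by apply: leq_trans pq; rewrite ltn_add2l.
rewrite ler_pM2l ?cell_mass_gt0// ler_pM2r ?invr_gt0 ?total_weight_gt0//.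
by apply: hc; rewrite leq_addr ltn_add2l.
Qed.

(** A quarter of the half-width of the bottom of the well, in the original coordinate. *)
Definition deep_radius k : R := 4 * (resolution R k)%:R * cell_length R k.+1.

Lemma deep_radius_gt0 k : 0 < deep_radius k.
Proof. by rewrite /deep_radius mulr_gt0 ?cell_length_gt0// mulr_gt0// ltr0n resolution_gt0. Qed.

Lemma deep_radius_le k : deep_radius k <= scale R k.
Proof.
rewrite /deep_radius /scale (cell_lengthS R k).
have := cell_length_gt0 R k.+1; move: (cell_length R k.+1) => l l0.
rewrite [l * _]mulrC mulrA ler_pM2r//.
rewrite -!natrM ler_nat; apply: leq_trans (_ : arity R k <= _)%N; last exact: leq_pmull.
rewrite /arity leq_mul2r; apply/orP; right.
by rewrite -[4%N]muln1 leq_mul// depth_gt0.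
Qed.

(** In units of one sixteenth of the half-width of the bottom, the point lies between 10 and
12 and the radii are 4 and 8: the small ball lies between 6 and 16, in the flat bottom,
and the large one contains the interval from 17 to 18. *)
Lemma deep_points_ratio k (x : R) : deep_points R k x ->
  ((expR ((depth R k)%:R / 17) / 10)%:E <=
   mu (closed_ball x (2 * deep_radius k)) / mu (closed_ball x (deep_radius k)))%E.
Proof.
case=> i [d [/andP[d1 d2] /digit_cellP /andP[x1 x2]]].
have l0 := cell_length_gt0 R k.+1; have r0 := deep_radius_gt0 k.
have r20 : 0 < 2 * deep_radius k by exact: mulr_gt0.
set l := cell_length R k.+1 in l0 x1 x2 *.
set n := resolution R k in d1 d2 *.
have n0 : 0 < n%:R :> R by rewrite ltr0n resolution_gt0.
have M0 := cell_mass_gt0 R k i; have Z0 := total_weight_gt0 R k.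
set b : int := i * (arity R k)%:Z.
have {}x1 : (b%:~R + 10 * n%:R) * l < x.
  apply: le_lt_trans x1; rewrite ler_pM2r// intrD lerD2l.
  by rewrite -natrM ler_nat.
have {}x2 : x <= (b%:~R + 12 * n%:R) * l.
  apply: le_trans x2 _; rewrite ler_pM2r// !intrD -addrA lerD2l.
  by rewrite -natrM -[d%:Z%:~R]/(d%:R) -[1%:~R]/(1%:R) -natrD addn1 ler_nat.
have rE : deep_radius k = 4 * (n%:R * l) by rewrite /deep_radius -mulrA.
rewrite !mulrDl -!(mulrA _ n%:R l) in x1 x2.
have nl0 : 0 < n%:R * l by rewrite mulr_gt0.
have nE (p q : nat) y : digit_range k.+1 (b + (p * n)%N%:Z) (q * n) y <->
    b%:~R * l + p%:R * (n%:R * l) < y <= b%:~R * l + (p + q)%N%:R * (n%:R * l).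
  have E1 : (b + (p * n)%N%:Z)%:~R * l = b%:~R * l + p%:R * (n%:R * l).
    by rewrite intrD mulrDl -[(_ * _)%N%:Z%:~R]/((p * n)%N%:R) natrM mulrA.
  have E2 : (b + (p * n)%N%:Z + (q * n)%N%:Z)%:~R * l = b%:~R * l + (p + q)%N%:R * (n%:R * l).
    rewrite -addrA -PoszD -mulnDl intrD mulrDl -[(_ * _)%N%:Z%:~R]/(((p + q) * n)%N%:R).
    by rewrite natrM mulrA.
  by split=> [/digit_rangeP|h]; [|apply/digit_rangeP]; rewrite E1 E2.
(* the three ranges of digits to which the two balls are compared; the third one only
   serves to show that the small ball has positive measure *)
have B1 : closed_ball x (deep_radius k) `<=` digit_range k.+1 (b + (6 * n)%N%:Z) (10 * n).
  rewrite closed_ball_itv// => y /=; rewrite in_itv/= => /andP[h1 h2].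
  by apply/nE; apply/andP; split; lra.
have B2 : digit_range k.+1 (b + (17 * n)%N%:Z) (1 * n) `<=` closed_ball x (2 * deep_radius k).
  rewrite closed_ball_itv// => y /nE /andP[h1 h2].
  by rewrite /= in_itv/=; apply/andP; split; lra.
have B3 : digit_range k.+1 (b + (12 * n)%N%:Z) (1 * n) `<=` closed_ball x (deep_radius k).
  rewrite closed_ball_itv// => y /nE /andP[h1 h2].
  by rewrite /= in_itv/=; apply/andP; split; lra.
have mB (r : R) : 0 < r -> measurable (closed_ball x r : set mble).
  by move=> ?; apply: closed_measurable; exact: closed_ball_closed.
(* [depth k >= 4] leaves room for 64 sixteenths in a cell *)
have aN (p : nat) : (p <= 64)%N -> (p * n <= arity R k)%N.
  move=> p64; rewrite /arity leq_mul2r; apply/orP; right; apply: leq_trans p64 _.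
  by rewrite -[64%N]/(16 * 4)%N leq_mul2l depth_ge4.
have U1 : (mu (closed_ball x (deep_radius k)) <=
    ((10 * n)%N%:R * (cell_mass R k i * (expR (- (depth R k)%:R) / total_weight R k)))%:E)%E.
  apply: le_trans (digit_range_child_le k i (6 * n) (10 * n) _ _ _).
  - by apply: le_measure; rewrite ?inE//; [exact: mB|exact: digit_range_measurable].
  - by rewrite -mulnDl; exact: aN.
  - move=> t /andP[_ /ltnW tn]; rewrite deep_weight//.
    by apply: leq_trans tn _; rewrite -mulnDl.
have L2 : (((1 * n)%N%:R * (cell_mass R k i * (expR (- (16 / 17 * (depth R k)%:R)) /
  total_weight R k)))%:E
    <= mu (closed_ball x (2 * deep_radius k)))%E.
  apply: le_trans (digit_range_child_ge k i (17 * n) (1 * n) _ _ _) _.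
  - by rewrite -mulnDl; exact: aN.
  - move=> t /andP[t1 /ltnW t2]; apply: shallow_weight.
    by rewrite t1/=; apply: leq_trans t2 _; rewrite -mulnDl.
  - by apply: le_measure; rewrite ?inE//; [exact: digit_range_measurable|exact: mB].
have P3 : (0 < mu (closed_ball x (deep_radius k)))%E.
  apply: lt_le_trans (_ : mu (digit_range k.+1 (b + (12 * n)%N%:Z) (1 * n)) <= _)%E; last first.
    by apply: le_measure; rewrite ?inE//; [exact: digit_range_measurable|exact: mB].
  rewrite digit_range_measure lte_fin mul1n -(prednK (resolution_gt0 R k : (0 < n)%N)).
  rewrite big_nat_recl//; apply: ltr_pwDl; first exact: cell_mass_gt0.
  by apply: sumr_ge0 => t _; exact/ltW/cell_mass_gt0.
have fin : mu (closed_ball x (deep_radius k)) \is a fin_num.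
  by rewrite ge0_fin_numE//; apply: le_lt_trans U1 _; rewrite ltry.
move: P3 U1; rewrite -(fineK fin); set u := fine _; rewrite lte_fin lee_fin => u0 U1.
rewrite inver gt_eqF//; apply: (@le_trans _ _ (((1 * n)%N%:R * (cell_mass R k i * (expR (- (16
  / 17 * (depth R k)%:R)) / total_weight R k)))%:E * u^-1%:E)%E); last first.
  by rewrite lee_wpmul2r// lee_fin invr_ge0 ltW.
rewrite -EFinM lee_fin ler_pdivlMr//.
apply: (@le_trans _ _ (expR ((depth R k)%:R / 17) / 10 * ((10 * n)%N%:R *
    (cell_mass R k i * (expR (- (depth R k)%:R) / total_weight R k))))).
  by rewrite ler_pM2l// divr_gt0// expR_gt0.
have -> : - (16 / 17 * (depth R k)%:R) = (depth R k)%:R / 17 - (depth R k)%:R :> R by lra.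
rewrite expRD mul1n natrM.
move: (expR (_ / 17)) (expR (- _)) (cell_mass R k i) (n%:R) => e1 e2 M nn.
rewrite le_eqVlt; apply/orP; left; apply/eqP; field; rewrite gt_eqF//.
Qed.

Lemma digits_locally_finite : locally_finite mu.
Proof.
move=> x; pose j := Num.floor x - 1; exists `]j%:~R, (j + 4%:Z)%:~R[%classic.
  split; first exact: itv_open.
  rewrite /= in_itv/= /j; have /andP[h1 h2] := floor_itv x.
  by move: h2; rewrite !intrD intrN => h2; apply/andP; split; lra.
apply: (@le_lt_trans _ _ (mu (digit_range 0 j 4))).
  apply: le_measure; rewrite ?inE.
  - exact: measurable_itv.
  - exact: digit_range_measurable.
  move=> y /=; rewrite in_itv/= => /andP[h1 h2]; apply/digit_rangeP.
  by rewrite /= !mulr1 h1 ltW.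
by rewrite digit_range_measure ltry.
Qed.

Lemma digits_nonzero : mu setT != 0%E.
Proof.
rewrite gt_eqF//; apply: (@lt_le_trans _ _ (mu (digit_cell R 0 0))).
  by rewrite mu_cell lte_fin ltr01.
by apply: le_measure; rewrite ?inE//; exact: digit_cell_measurable.
Qed.

Lemma depth_unbounded (A : R) : exists K, forall k, (K <= k)%N ->
  A <= expR ((depth R k)%:R / 17) / 10.
Proof.
pose j := (Num.truncn (170 * A)).+1; exists ((2 * exp_base R) ^ j)%N => k Kk.
have jd : (j <= depth R k)%N.
  apply: leq_trans (leq_addl _ _); apply: trunc_log_max; last exact: leqW.
  by rewrite mulSn mul1n /exp_base addnS ltnS.
have jA : 170 * A < (depth R k)%:R.
  by apply: lt_le_trans (truncnS_gt _) _; rewrite ler_nat.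
have := expR_ge1Dx ((depth R k)%:R / 17 : R); lra.
Qed.

Lemma frequently_deep_doubling (x : R) :
  (forall K, exists2 k, (K <= k)%N & deep_points R k x) -> doubling_limsup mu x = +oo%E.
Proof.
move=> hx; apply/eqP; rewrite -leye_eq /doubling_limsup /limf_esup.
apply: le_ereal_inf_tmp => _ [V [e /= e0 eV] <-].
rewrite leye_eq; apply/eqP/eq_infty => A.
have [K hK] := depth_unbounded A.
have : `|2^-1| < 1 :> R by rewrite ger0_norm// invf_lt1// ltr1n.
move=> /cvg_expr /cvgrPdist_lt /(_ e e0) [K' _ hK'].
have [k Kk kx] := hx (maxn K K').
have r0 := deep_radius_gt0 k.
apply: (@le_trans _ _ (mu (closed_ball x (2 * deep_radius k)) / mu (closed_ball x (deep_radius
  k)))%E).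
  apply: le_trans (deep_points_ratio k x kx).
  by rewrite lee_fin; apply: hK; apply: leq_trans Kk; exact: leq_maxl.
apply: ereal_sup_ubound; exists (deep_radius k) => //; apply: eV => //=.
rewrite sub0r normrN gtr0_norm//.
apply: le_lt_trans (deep_radius_le k) _; apply: le_lt_trans (scale_le R k) _.
have := hK' k (leq_trans (leq_maxr _ _) Kk).
by rewrite /= sub0r normrN exprVn ger0_norm// invr_ge0 exprn_ge0.
Qed.

Lemma digits_non_doubling : non_doubling mu.
Proof.
apply: negligibleS (eventually_shallow_negligible R mu mu_cell) => x nx.
apply: contrapT => h; apply: nx; apply: frequently_deep_doubling => K.
apply: contrapT => h'; apply: h; exists K => k Kk kx; apply: h'.
by exists k.
Qed.

Lemma digits_tangent_equivalent (x : R) (nu : {measure set mble -> \bar R}) :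
  tangent_measure mu x nu -> equivalent_measures lebesgue_measure nu.
Proof.
move=> [nu_lf nu0 [c [r [c0 r0 rlim lim_m]]]].
have [m_ mE] : exists m_ : nat -> {measure set mble -> \bar R},
    forall i, (m_ i : set mble -> \bar R) = rescaling mu x (c i) (r i).
  exists (fun i => sval (cid (rescaling_measure R mu x (c i) (r i) (c0 i)))) => i.
  by case: cid.
have lim_m' : weak_limit (fun i => m_ i : set mble -> \bar R) nu.
  by rewrite (_ : (fun i => _) = fun i => rescaling mu x (c i) (r i))//; apply/funext => i.
have win := eventually_windows R mu mu_cell x c r m_ c0 r0 rlim mE.
split; first exact: lebesgue_dominated_by_limit lim_m' win nu_lf nu0.
exact: limit_absolutely_continuous lim_m' win nu_lf nu0.
Qed.

End DeepRatio.

Theorem theorem1p2 (R : realType) :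
  exists mu : {measure set (measurableTypeR R) -> \bar R},
    [/\ locally_finite mu,
        mu setT != 0%E,
        non_doubling mu &
        forall (x : R) (nu : {measure set (measurableTypeR R) -> \bar R}),
          tangent_measure mu x nu ->
          equivalent_measures lebesgue_measure nu].
Proof.
have [mu mu_cell] := measure_of_digits R; exists mu; split.
- exact: digits_locally_finite mu_cell.
- exact: digits_nonzero mu_cell.
- exact: digits_non_doubling mu_cell.
- exact: digits_tangent_equivalent mu_cell.
Qed.
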